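(* Let $0<p\le1<q\le\infty$ and let $s\ge0$ be an integer. If $f\in LH^{p,q,s}(\mathbf{R}^+)$, then $$\|Hf\|_{H^{p,q,s}(\mathbf{R}^+)}\le q'\,\|f\|_{LH^{p,q,s}(\mathbf{R}^+)} .$$
   Context: $\mathbf{R}^+=(0,\infty)$. Hardy operator: $Hf(x)=\frac1x\int_0^x f(t)\,dt$ for $x>0$. $q'=q/(q-1)$ for $1<q<\infty$ and $\infty'=1$; $1/q=0$ when $q=\infty$. A $(p,q,s)$-atom is a function $a$ on $\mathbf{R}^+$ such that for some $0<x_0<x_1<\infty$: (i) $\operatorname{supp} a\subset(x_0,x_1)$; (ii) $\|a\|_{L^q(\mathbf{R}^+)}\le(x_1-x_0)^{1/q-1/p}$; (iii) $\int_0^\infty a(x)x^\beta\,dx=0$ for $\beta=0,1,\dots,s$. An $L$-$(p,q,s)$-atom is a $(p,q,s)$-atom that also satisfies (iv) $\int_0^\infty a(x)\ln x\,dx=0$. $H^{p,q,s}(\mathbf{R}^+)$ (respectively $LH^{p,q,s}(\mathbf{R}^+)$) is the set of all $f=\sum_{k=1}^\infty\lambda_k a_k$, where each $a_k$ is a $(p,q,s)$-atom (respectively an $L$-$(p,q,s)$-atom), $\sum_k|\lambda_k|^p<\infty$, and the series converges in the sense of distributions. The quasinorms $\|f\|_{H^{p,q,s}(\mathbf{R}^+)}$ and $\|f\|_{LH^{p,q,s}(\mathbf{R}^+)}$ are $\inf\left(\sum_k|\lambda_k|^p\right)^{1/p}$, the infimum being over all decompositions of $f$ of the respective type. For $f=\sum_k\lambda_k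 a_k\in LH^{p,q,s}(\mathbf{R}^+)$, $Hf$ is understood termwise as $Hf=\sum_k\lambda_k Ha_k$. Standing convention: all functions are assumed not identically zero.
   Formalization: Hf is taken to be any distribution equal to ∑λ_k Ha_k for some L-atomic decomposition of f for which this series converges in the sense of distributions; convergence is assumed, being automatic for 1/p ≤ s+3 but failing for some decompositions when 1/p > s+3. *)

(* Defs.v *)
From HB Require Import structures.
From mathcomp Require Import all_boot all_order all_algebra.
From mathcomp Require Import all_classical all_reals all_analysis.

Set Implicit Arguments.
Unset Strict Implicit.
Unset Printing Implicit Defensive.

Import Order.TTheory GRing.Theory Num.Theory.
Import numFieldNormedType.Exports.

Local Open Scope classical_set_scope.
Local Open Scope ring_scope.

(* A function on (0, +oo) is represented by a total function R -> R whose
   values outside (0, +oo) are never used. *)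
Definition Rplus (R : realType) : set R := `]0, +oo[%classic.

(** Distributions on (0, +oo) *)

Definition supported_within (R : realType) (phi : R -> R) (a b : R) : Prop :=
  forall x, phi x != 0 -> a <= x <= b.

(* The space D(0, +oo); its elements are extended by 0 to the whole line. *)
Definition test_function (R : realType) (phi : R -> R) : Prop :=
  (forall n x, derivable (derive1n n phi) x 1) /\
  (exists a b : R, 0 < a /\ supported_within phi a b).

(* The pairing is only meaningful on test functions.  Continuity is stated by
   the usual seminorm estimate on each D([a, b]), with M playing the role of
   the maximum over n <= N of the sup norms of the n-th derivatives. *)
Record distribution_on_Rplus (R : realType) := DistributionOnRplus {
  pairing :> (R -> R) -> R;
  pairing_linear : forall (c : R) (phi psi : R -> R),
    test_function phi -> test_function psi ->
    pairing (fun x => c * phi x + psi x) = c * pairing phi + pairing psi;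
  pairing_continuous : forall a b : R, 0 < a ->
    exists (N : nat) (C : R), forall (phi : R -> R) (M : R),
      test_function phi -> supported_within phi a b ->
      (forall n x, (n <= N)%N -> `|derive1n n phi x| <= M) ->
      `|pairing phi| <= C * M }.

Definition nonzero_distribution (R : realType)
    (f : distribution_on_Rplus R) : Prop :=
  exists2 phi, test_function phi & f phi != 0.

Definition integrate_against (R : realType) (a phi : R -> R) : R :=
  \int[lebesgue_measure]_(x in @Rplus R) (a x * phi x).

Definition sum_in_distributions (R : realType) (lam : nat -> R)
    (a : nat -> R -> R) (f : distribution_on_Rplus R) : Prop :=
  forall phi, test_function phi ->
    series (fun k => lam k * integrate_against (a k) phi) @ \oo --> f phi.

(** Atoms *)

Definition LqRplus_norm (R : realType) (q : \bar R) (a : R -> R) : \bar R :=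
  'N[lebesgue_measure]_q[(EFin \o a) \_ (@Rplus R)]%E.

(* [fine q^-1] is 1/q, with 1/q = 0 for q = +oo. *)
Definition atom (R : realType) (p : R) (q : \bar R) (s : nat)
    (a : R -> R) : Prop :=
  measurable_fun (@Rplus R) a /\
  (exists x0 x1 : R, [/\ 0 < x0, x0 < x1,
     closure [set x | Rplus x /\ a x != 0] `<=` `]x0, x1[%classic &
     (LqRplus_norm q a <= ((x1 - x0) `^ (fine q^-1 - p^-1))%:E)%E]) /\
  (forall beta, (beta <= s)%N ->
     \int[lebesgue_measure]_(x in @Rplus R) (a x * x ^+ beta) = 0).

Definition Latom (R : realType) (p : R) (q : \bar R) (s : nat)
    (a : R -> R) : Prop :=
  atom p q s a /\
  \int[lebesgue_measure]_(x in @Rplus R) (a x * ln x) = 0.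

(** Atomic spaces; A is the class of admissible atoms *)

Definition atomic_decomposition (R : realType) (A : set (R -> R)) (p : R)
    (f : distribution_on_Rplus R) (lam : nat -> R) (a : nat -> R -> R) : Prop :=
  [/\ forall k, A (a k),
      cvgn (series (fun k => `|lam k| `^ p)) &
      sum_in_distributions lam a f].

Definition atomic_space (R : realType) (A : set (R -> R)) (p : R)
    : set (distribution_on_Rplus R) :=
  [set f | exists lam a, atomic_decomposition A p f lam a].

(* Extended-real valued: it is +oo exactly outside of [atomic_space A p]. *)
Definition atomic_quasinorm (R : realType) (A : set (R -> R)) (p : R)
    (f : distribution_on_Rplus R) : \bar R :=
  ereal_inf [set N | exists lam a, atomic_decomposition A p f lam a /\
    N = ((limn (series (fun k => `|lam k| `^ p))) `^ p^-1)%:E].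

Definition Hspace (R : realType) (p : R) (q : \bar R) (s : nat) :=
  atomic_space (@atom R p q s) p.

Definition LHspace (R : realType) (p : R) (q : \bar R) (s : nat) :=
  atomic_space (@Latom R p q s) p.

Definition Hnorm (R : realType) (p : R) (q : \bar R) (s : nat) :=
  atomic_quasinorm (@atom R p q s) p.

Definition LHnorm (R : realType) (p : R) (q : \bar R) (s : nat) :=
  atomic_quasinorm (@Latom R p q s) p.

(** The Hardy operator *)

Definition hardy (R : realType) (a : R -> R) (x : R) : R :=
  x^-1 * \int[lebesgue_measure]_(t in `]0, x[) a t.

(* g is a value of Hf computed termwise from some decomposition
   f = \sum_k lam_k a_k into L-atoms.  Neither the convergence of
   \sum_k lam_k H(a_k) for the other decompositions of f, nor the independence
   of its sum from the decomposition, is assumed. *)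
Definition termwise_hardy (R : realType) (p : R) (q : \bar R) (s : nat)
    (f g : distribution_on_Rplus R) : Prop :=
  exists lam a, atomic_decomposition (@Latom R p q s) p f lam a /\
    sum_in_distributions lam (fun k => hardy (a k)) g.

(* Main.v *)
(* For a single L-atom a on an interval I, the cancellation of a against 1 and ln
   makes Ha supported in I with the moments required of an atom, and Hardy's
   inequality gives |Ha|_q <= q' |a|_q, so Ha / q' is an atom.  It remains to
   compare Hf, computed from one decomposition of f, with the other ones.

   If 1/p <= s + 2, every atom pairs with a test function phi by at most a
   constant C(phi), so all the series converge absolutely.  The adjoint of H
   maps phi to t |-> int_t^oo phi(x) dx / x, which is not compactly supported in
   (0, oo), but it maps phi - phi(. / d) to a test function; letting d -> oo
   shows that every decomposition of f yields the same Hf.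

   If 1/p > s + 2, the quasinorm of H^{p,q,s} vanishes identically: the
   derivative of order s + 1 of a Dirac mass is a limit of multiples of atoms
   whose coefficients tend to 0, and every element of the space is a limit of
   finite combinations of such derivatives.  Passing from one approximation to
   the next in many small steps keeps the partial sums of the resulting series
   of atoms convergent. *)
Require Import Defs.
From mathcomp Require Import all_boot all_order all_algebra.
From mathcomp Require Import all_classical all_reals all_analysis.
From mathcomp Require Import measurable_realfun.
From mathcomp Require Import ring lra.
Import Order.TTheory GRing.Theory Num.Theory.
Import numFieldNormedType.Exports.
Local Open Scope classical_set_scope.
Local Open Scope ring_scope.
Set Implicit Arguments.
Unset Strict Implicit.
Unset Printing Implicit Defensive.

(** * Calculus on the line and test functions *)

(** The threshold s + 2 comes from scaling. On an interval of length l an atom has L^1 norm at most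
    l^(1 - 1/p), and its vanishing moments gain a factor l^(s+1) against a smooth phi; the product
    l^(s + 2 - 1/p) stays bounded for small l exactly when 1/p <= s + 2. Conversely, a difference
    quotient of order s + 1 at scale e is an atom times a coefficient of order e^(1/p - s - 2),
    which tends to 0 beyond the threshold. In the first case, the continuity of Hf says nothing
    about the dilates phi(. / d), whose supports leave every compact set. Their pairings are shown
    to tend to 0 on the series itself, atom by atom, since each Ha has bounded support. In the
    second case the series need not converge absolutely against test functions. Only limits of
    partial sums can be used, and the new decomposition has to converge along all indices, not only
    along the ends of blocks. *)

Lemma is_derive_add (R : realType) (f g : R -> R) (x a b : R) :
  is_derive x 1 f a -> is_derive x 1 g b ->
  is_derive x 1 (fun y => f y + g y) (a + b).
Proof. exact: is_deriveD. Qed.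

Lemma is_derive_sub (R : realType) (f g : R -> R) (x a b : R) :
  is_derive x 1 f a -> is_derive x 1 g b ->
  is_derive x 1 (fun y => f y - g y) (a - b).
Proof. exact: is_deriveB. Qed.

Lemma is_derive_scale (R : realType) (f : R -> R) (c x a : R) :
  is_derive x 1 f a -> is_derive x 1 (fun y => c * f y) (c * a).
Proof. exact: is_deriveZ. Qed.

Lemma is_derive_mul (R : realType) (f g : R -> R) (x a b : R) :
  is_derive x 1 f a -> is_derive x 1 g b ->
  is_derive x 1 (fun y => f y * g y) (f x * b + g x * a).
Proof. exact: is_deriveM. Qed.

Lemma is_derive_exprn (R : realType) (n : nat) (x : R) :
  is_derive x 1 (fun y => y ^+ n) (n%:R * x ^+ n.-1).
Proof.
have := @is_deriveX R R id n x 1 1 (is_derive_id _ _).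
rewrite /GRing.scale /= mulr1 => h.
suff -> : (fun y : R => y ^+ n) = (id : R -> R) ^+ n by [].
elim: n {h} => [|n ih]; apply/funext => y //.
by rewrite !exprS -ih.
Qed.

Lemma is_derive_bigsum (R : realType) (n : nat) (f : nat -> R -> R)
    (df : nat -> R) (x : R) :
  (forall i, is_derive x 1 (f i) (df i)) ->
  is_derive x 1 (fun y => \sum_(i < n) f i y) (\sum_(i < n) df i).
Proof.
move=> h; elim: n => [|n ih].
  rewrite big_ord0 (_ : (fun _ => _) = cst 0); first exact: is_derive_cst.
  by apply/funext => y; rewrite big_ord0.
rewrite big_ord_recr /= (_ : (fun _ => _) =
  fun y => \sum_(i < n) f i y + f n y); first exact: is_derive_add.
by apply/funext => y; rewrite big_ord_recr.
Qed.

Lemma is_derive_continuous (R : realType) (f f' : R -> R) :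
  (forall x : R, is_derive x 1 f (f' x)) -> continuous f.
Proof.
by move=> h x; have [d _] := h x; exact/differentiable_continuous/derivable1_diffP.
Qed.

Lemma is_derive_within_continuous (R : realType) (f f' : R -> R) (u v : R) :
  (forall x : R, u <= x <= v -> is_derive x 1 f (f' x)) ->
  {within `[u, v], continuous f}.
Proof.
move=> h; apply: derivable_within_continuous => x.
by rewrite in_itv /= => /h [].
Qed.

Lemma le_derive_increment (R : realType) (f f' : R -> R) (u v E : R) :
  u <= v -> (forall x : R, u <= x <= v -> is_derive x 1 f (f' x)) ->
  (forall x : R, u <= x <= v -> `|f' x| <= E) -> `|f v - f u| <= E * (v - u).
Proof.
move=> uv df bf.
have [||c] := @MVT_segment R f f' u v uv.
- move=> x; rewrite in_itv /= => /andP[ux xv].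
  by apply: df; rewrite (ltW ux) (ltW xv).
- exact: is_derive_within_continuous df.
rewrite in_itv /= => cuv ->; rewrite normrM (ger0_norm (_ : 0 <= v - u)) ?subr_ge0//.
by rewrite ler_wpM2r ?subr_ge0 ?bf.
Qed.

Lemma is_derive_monomial_sum (R : realType) (c : nat -> R) (n : nat) (x : R) :
  is_derive x 1 (fun y => \sum_(i < n) c i * y ^+ i)
    (\sum_(i < n) c i * (i%:R * x ^+ i.-1)).
Proof.
exact: (@is_derive_bigsum R n (fun i y => c i * y ^+ i)
  (fun i => c i * (i%:R * x ^+ i.-1)) x
  (fun i => @is_derive_scale _ _ (c i) _ _ (is_derive_exprn i x))).
Qed.

(** Taylor's formula by repeated integration: a polynomial close to [F 1] is integrated, and its
    constant is adjusted so that the difference vanishes at u. [F] is a bare list of successive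
    derivatives because [quadrature] applies this to functions that are differentiable only finitely
    often. *)
Lemma poly_approx (R : realType) (u v E C : R) (k : nat) (F : nat -> R -> R) :
  u <= v ->
  (forall (i : nat) (x : R), (i < k)%N -> u <= x <= v ->
    is_derive x 1 (F i) (F i.+1 x)) ->
  (forall x : R, u <= x <= v -> `|F k x - C| <= E) ->
  exists c : nat -> R, forall x : R, u <= x <= v ->
    `|F 0%N x - \sum_(i < k.+1) c i * x ^+ i| <= E * (v - u) ^+ k.
Proof.
move=> uv; elim: k F => [|k ih] F dF bF.
  exists (fun=> C) => x xuv.
  by rewrite big_ord_recl big_ord0 addr0 expr0 !mulr1 bF.
have [||c hc] := ih (fun i => F i.+1); first by move=> i x ik; exact: dF.
  by move=> x; exact: bF.
pose d i := if i is j.+1 then c j / j.+1%:R else 0.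
pose P x : R := \sum_(i < k.+2) d i * x ^+ i.
have dP (x : R) : is_derive x 1 P (\sum_(i < k.+1) c i * x ^+ i).
  apply: (is_derive_eq (is_derive_monomial_sum d k.+2 x)).
  rewrite big_ord_recl /= mul0r add0r; apply: eq_bigr => i _ /=.
  by rewrite /d /= mulrA divfK// pnatr_eq0.
have E0 : 0 <= E by rewrite (le_trans _ (bF u _)) ?lexx//.
pose B : R := F 0%N u - P u.
exists (fun i => (if i == 0%N then B else 0) + d i) => x /andP[ux xv].
have -> : \sum_(i < k.+2) ((if i == 0%N :> nat then B else 0) + d i) * x ^+ i = B + P x.
  under eq_bigr do rewrite mulrDl.
  rewrite big_split /= big_ord_recl /= expr0 mulr1 big1 ?addr0//.
  by move=> i _; rewrite mul0r.
have -> : F 0%N x - (B + P x) = (F 0%N x - P x) - (F 0%N u - P u).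
  by rewrite /B; ring.
apply: (@le_trans _ _ (E * (v - u) ^+ k * (x - u))).
  apply: (@le_derive_increment _ (fun y => F 0%N y - P y)
    (fun y => F 1%N y - \sum_(i < k.+1) c i * y ^+ i)) => // y /andP[uy yx].
    by apply: is_derive_sub (dP y); apply: dF; rewrite // uy (le_trans yx).
  by apply: hc; rewrite uy (le_trans yx).
rewrite exprSr -!mulrA ler_wpM2l// ler_wpM2l ?exprn_ge0 ?subr_ge0//.
by rewrite lerB.
Qed.

Fixpoint findiff (R : realType) (e : R) (k : nat) (f : R -> R) (y : R) : R :=
  if k is k'.+1 then findiff e k' f (y + e) - findiff e k' f y else f y.

Lemma findiffE (R : realType) (e : R) (k : nat) (f : R -> R) (y : R) :
  findiff e k.+1 f y = findiff e k (fun x => f (x + e) - f x) y.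
Proof.
elim: k y => [//|k ih] y.
by rewrite -[LHS]/(findiff e k.+1 f (y + e) - findiff e k.+1 f y) !ih.
Qed.

Lemma is_derive_shift (R : realType) (f : R -> R) (x e a : R) :
  is_derive (x + e) 1 f a -> is_derive x 1 (fun y => f (y + e)) a.
Proof.
move=> h; rewrite -[a]mulr1; apply: (@is_derive1_comp _ f (fun y => y + e)) => //.
rewrite -[X in is_derive _ _ _ X]addr0.
exact: is_derive_add (is_derive_id _ _) (is_derive_cst _ _ _).
Qed.

(** Induction on the order, applied to the increments of the F i over e; [findiffE] allows this
    difference to be taken first. The increment of [F k] left at the end is e times a value of
    [F k.+1]. *)
Lemma findiff_mean_value (R : realType) (e : R) (k : nat) (F : nat -> R -> R)
    (y : R) : 0 < e ->
  (forall (i : nat) (x : R), (i < k)%N -> y <= x -> is_derive x 1 (F i) (F i.+1 x)) ->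
  exists2 xi, y <= xi <= y + k%:R * e & findiff e k (F 0%N) y = e ^+ k * F k xi.
Proof.
move=> e0; elim: k F => [|k ih] F dF.
  by exists y; rewrite ?mul0r ?addr0 ?lexx// expr0 mul1r.
rewrite findiffE.
have [|xi /andP[yxi xik] ->] := ih (fun i x => F i (x + e) - F i x).
  move=> i x ik yx; apply: is_derive_sub; last by apply: dF => //; exact: ltnW.
  by apply: is_derive_shift; apply: dF; [exact: ltnW|rewrite ler_wpDr// ltW].
have [|||c] := @MVT_segment R (F k) (F k.+1) xi (xi + e); first by rewrite lerDl ltW.
- move=> x; rewrite in_itv /= => /andP[xix _]; apply: dF => //.
  by rewrite (le_trans yxi)// ltW.
- apply: (@is_derive_within_continuous _ _ (F k.+1)) => x /andP[xix _].
  by apply: dF => //; rewrite (le_trans yxi).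
rewrite in_itv /= => /andP[xic cxi] ->; exists c.
  rewrite (le_trans yxi)//= (le_trans cxi)// -natr1 mulrDl mul1r addrA.
  by rewrite lerD2r.
by rewrite addrC addKr exprSr [in RHS]mulrAC mulrA.
Qed.

Lemma primitive_exists (R : realType) (f : R -> R) (a : R) :
  continuous f -> (forall x, x <= a -> f x = 0) ->
  exists2 F : R -> R, forall x : R, is_derive x 1 F (f x) &
    forall x, x <= a -> F x = 0.
Proof.
move=> cf f0.
(* Starting at a - 1 rather than at a puts every x >= a strictly inside the interval of the
   fundamental theorem; nothing is added to the integral, since f vanishes up to a. *)
pose F (x : R) := \int[lebesgue_measure]_(t in `[a - 1, x]) f t.
have F0 x : x <= a -> F x = 0.
  move=> xa; rewrite /F (@eq_Rintegral _ _ _ _ _ (fun=> 0)) => [|y].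
    by rewrite Rintegral_cst// mul0r.
  by rewrite inE /= in_itv /= => /andP[_ yx]; rewrite f0// (le_trans yx).
exists F => // x; have [xa|ax] := ltP x a.
  rewrite (f0 _ (ltW xa)); apply: (@near_eq_is_derive _ _ _ (cst 0)).
  near=> y; rewrite F0 //; apply/ltW; near: y; exact: lt_nbhsl.
have [||||dF FE] := @continuous_FTC1_closed R f (a - 1) x (x + 1).
- by rewrite ltrDl.
- apply: continuous_compact_integrable; first exact: segment_compact.
  exact: continuous_subspaceT.
- by rewrite ltrBlDr ltr_pwDr.
- exact: cf.
by apply: DeriveDef => //; rewrite -derive1E FE.
Unshelve. all: by end_near. Qed.

Lemma derive1n_seq (R : realType) (F : nat -> R -> R) (n : nat) :
  (forall (i : nat) (x : R), is_derive x 1 (F i) (F i.+1 x)) ->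
  derive1n n (F 0%N) = F n.
Proof.
move=> dF; elim: n => [//|n ih]; rewrite derive1nS ih.
by apply/funext => x; rewrite derive1E; apply: derive_val.
Qed.

(** Smoothness is checked by exhibiting all derivatives at once, without computing iterated
    [derive1n]. *)
Lemma test_functionP (R : realType) (F : nat -> R -> R) (a b : R) : 0 < a ->
  (forall (i : nat) (x : R), is_derive x 1 (F i) (F i.+1 x)) ->
  supported_within (F 0%N) a b -> test_function (F 0%N).
Proof.
move=> a0 dF sF; split; last by exists a, b.
by move=> n x; rewrite (derive1n_seq n dF); case: (dF n x).
Qed.

Lemma is_derive_test (R : realType) (phi : R -> R) (n : nat) (x : R) :
  test_function phi -> is_derive x 1 (derive1n n phi) (derive1n n.+1 phi x).
Proof.
by move=> [dphi _]; apply: DeriveDef => //; rewrite derive1nS derive1E.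
Qed.

Lemma continuous_test (R : realType) (phi : R -> R) (n : nat) :
  test_function phi -> continuous (derive1n n phi).
Proof.
by move=> tphi; apply: is_derive_continuous => x; exact: is_derive_test.
Qed.

Lemma supported_derive1n (R : realType) (phi : R -> R) (a b : R) (n : nat) :
  supported_within phi a b -> supported_within (derive1n n phi) a b.
Proof.
move=> sphi x; apply: contra_neqT => nx.
have : \near x, derive1n n phi x = 0.
  have : \near x, ~~ (a <= x <= b).
    move: nx; rewrite negb_and -!ltNge => /orP[xa|bx].
      near=> y; rewrite negb_and -!ltNge; apply/orP; left.
      by near: y; exact: lt_nbhsl.
    near=> y; rewrite negb_and -!ltNge; apply/orP; right.
    by near: y; exact: lt_nbhsr.
  elim: n => [|n ih] ny.
    near=> y; apply/eqP; apply: contraT => /sphi.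
    by rewrite (negbTE (near ny y _)).
  (* Vanishing near x also holds near every y close to x, so at such y the next derivative is that
     of a locally zero function. *)
  have /near_join := ih ny; apply: filterS => y hy.
  rewrite derive1nS derive1E (@near_eq_derive _ _ _ _ (cst 0)); last exact: hy.
  exact: derive_cst.
by move/nbhs_singleton.
Unshelve. all: by end_near. Qed.

Lemma bounded_derive1n (R : realType) (phi : R -> R) (n : nat) :
  test_function phi -> exists M : R, forall x, `|derive1n n phi x| <= M.
Proof.
move=> tphi; have [_ [a [b [a0 sphi]]]] := tphi.
have sn := supported_derive1n (n := n) sphi.
have [ab|ba] := leP a b; last first.
  exists 0 => x; have [->|/sn] := eqVneq (derive1n n phi x) 0.
    by rewrite normr0.
  by case/andP => ax xb; move: ba; rewrite ltNge (le_trans ax xb).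
have [|c _ hc] := @EVT_max R (fun x => `|derive1n n phi x|) a b ab.
  apply: continuous_subspaceT => x.
  apply: (@continuous_comp _ _ _ (derive1n n phi) Num.norm).
    exact: continuous_test.
  exact: norm_continuous.
exists `|derive1n n phi c| => x.
have [->|/sn xab] := eqVneq (derive1n n phi x) 0; first by rewrite normr0.
by apply: hc; rewrite in_itv.
Qed.

Lemma bounded_derivatives (R : realType) (phi : R -> R) (n : nat) :
  test_function phi ->
  exists M : R, forall i x, (i <= n)%N -> `|derive1n i phi x| <= M.
Proof.
move=> tphi; elim: n => [|n [M hM]].
  have [M hM] := bounded_derive1n 0 tphi.
  by exists M => i x; rewrite leqn0 => /eqP ->; exact: hM.
have [N hN] := bounded_derive1n n.+1 tphi.
exists (Num.max M N) => i x; rewrite leq_eqVlt => /predU1P[->|].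
  by rewrite le_max hN orbT.
by rewrite ltnS => /hM h; rewrite le_max h.
Qed.

(** Replaces a closed formula for the n-th derivative of phi x / x by a family stable under
    derivation, here [laurent_span]. *)
Lemma derivable_in_class (R : realType) (S : set (R -> R)) :
  (forall f, S f -> exists2 g, S g & forall x : R, is_derive x 1 f (g x)) ->
  forall f, S f -> forall n (x : R), derivable (derive1n n f) x 1.
Proof.
move=> dS f Sf n.
have : S (derive1n n f).
  elim: n => [//|n /dS[g Sg dg]]; rewrite derive1nS.
  suff -> : (derive1n n f)^`()%classic = g by [].
  by apply/funext => x; rewrite derive1E; apply: derive_val.
by move=> /dS[g _ dg] x; case: (dg x).
Qed.

(* Stable under derivation when [F n] is the n-th derivative of a function that
   vanishes near 0. *)
Inductive laurent_span (R : realType) (F : nat -> R -> R) : (R -> R) -> Prop :=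
| LaurentSpan n k c : laurent_span F (fun x => c * (F n x * x ^- k))
| LaurentSpanD f g : laurent_span F f -> laurent_span F g ->
    laurent_span F (fun x => f x + g x).

Lemma is_derive_exprVn (R : realType) (k : nat) (x : R) : x != 0 ->
  is_derive x 1 (fun y => y ^- k) (- k%:R * x ^- k.+1).
Proof.
move=> x0; have xk0 : x ^+ k != 0 by rewrite expf_neq0.
have := @is_deriveV R (fun y => y ^+ k) x _ 1 xk0 (is_derive_exprn k x).
move=> h; apply: (is_derive_eq h); rewrite /GRing.scale /=.
case: k xk0 {h} => [|k] xk0; first by rewrite !mul0r oppr0 mulr0 mul0r.
rewrite /= !exprS in xk0 *; move: xk0; rewrite mulf_eq0 negb_or => /andP[_].
set y := x ^+ k; set m := _%:R => y0; rewrite expr0; field.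
by rewrite y0 x0.
Qed.

Lemma test_function_div (R : realType) (phi : R -> R) :
  test_function phi -> test_function (fun x => phi x / x).
Proof.
move=> tphi; have [_ [a [b [a0 sphi]]]] := tphi; split; last first.
  exists a, b; split => // x /eqP h; apply: sphi; apply/eqP => h'; apply: h.
  by rewrite h' mul0r.
pose F n := derive1n n phi.
apply: (@derivable_in_class _ (laurent_span F)); last first.
  have := LaurentSpan F 0 1 1.
  by congr laurent_span; apply/funext => x; rewrite mul1r expr1.
move=> f; elim => {f} [n k c|f g _ [f' Sf df] _ [g' Sg dg]]; last first.
  exists (fun x => f' x + g' x); first exact: LaurentSpanD.
  by move=> x; exact: is_derive_add.
exists (fun x => c * (F n.+1 x * x ^- k) + (c * - k%:R) * (F n x * x ^- k.+1)).
  by apply: LaurentSpanD; exact: LaurentSpan.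
(* To the left of a every term is locally zero, so negative powers are differentiated only at points
   x > 0. *)
move=> x; have [xa|ax] := ltP x a.
  have F0 i y : y < a -> F i y = 0.
    move=> ya; apply/eqP; apply: contraT => /(supported_derive1n sphi).
    by rewrite leNgt ya.
  rewrite !F0// !mul0r !mulr0 addr0.
  apply: (@near_eq_is_derive _ _ _ (cst 0)).
  by near=> y; rewrite F0 ?mul0r ?mulr0//; near: y; exact: lt_nbhsl.
have x0 : x != 0 by rewrite gt_eqF// (lt_le_trans a0).
have h := is_derive_mul (is_derive_test n x tphi) (is_derive_exprVn k x0).
apply: (is_derive_eq (is_derive_scale c h)); rewrite /F; ring.
Unshelve. all: by end_near. Qed.

Lemma is_derive_dilation (R : realType) (f : R -> R) (d x a : R) :
  is_derive (x / d) 1 f a -> is_derive x 1 (fun y => f (y / d)) (d^-1 * a).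
Proof.
move=> h; rewrite mulrC; apply: (@is_derive1_comp _ f (fun y => y / d)) => //.
apply: (is_derive_eq (is_derive_mul (is_derive_id _ _) (is_derive_cst _ _ _))).
by rewrite mulr0 add0r mulr1.
Qed.

Definition dilate (R : realType) (d : R) (phi : R -> R) (x : R) : R := phi (x / d).

Lemma derive1n_dilate (R : realType) (phi : R -> R) (d : R) (n : nat) (x : R) :
  test_function phi ->
  derive1n n (dilate d phi) x = d ^- n * derive1n n phi (x / d).
Proof.
move=> tphi; have := @derive1n_seq R (fun i y => d ^- i * derive1n i phi (y / d)) n.
have -> : (fun y => d ^- 0 * derive1n 0 phi (y / d)) = dilate d phi.
  by apply/funext => y; rewrite expr0 invr1 mul1r.
move=> h; rewrite (h _)// => i y; rewrite exprSr invfM -mulrA.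
by apply/is_derive_scale/is_derive_dilation/is_derive_test.
Qed.

Lemma test_function_dilate (R : realType) (phi : R -> R) (d : R) :
  0 < d -> test_function phi -> test_function (dilate d phi).
Proof.
move=> d0 tphi; have [_ [a [b [a0 sphi]]]] := tphi.
have := @test_functionP R (fun i y => d ^- i * derive1n i phi (y / d)) (d * a) (d * b).
have -> : (fun y => d ^- 0 * derive1n 0 phi (y / d)) = dilate d phi.
  by apply/funext => y; rewrite expr0 invr1 mul1r.
apply; first exact: mulr_gt0.
  move=> i y; rewrite exprSr invfM -mulrA.
  by apply/is_derive_scale/is_derive_dilation/is_derive_test.
by move=> x /sphi; rewrite ler_pdivlMr// ler_pdivrMr// !(mulrC d).
Qed.

(* The adjoint of the Hardy operator sends [phi] to the function
   [t |-> Theta oo - Theta t], which is constant but nonzero near [0] in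
   general; subtracting the dilated function restores compact support. *)
Lemma adjoint_primitive (R : realType) (phi : R -> R) :
  test_function phi ->
  exists2 Theta : R -> R, forall x : R, is_derive x 1 Theta (phi x / x) &
    forall d, 1 <= d -> test_function (fun t => Theta (t / d) - Theta t).
Proof.
move=> tphi; have tth := test_function_div tphi.
have [_ [a [b0 [a0 sth0]]]] := tth.
(* The bound b0 may lie below a when the support is empty; the maximum keeps b positive, and the
   added 1 makes phi y / y vanish from b on, b included. *)
pose b := Num.max a b0 + 1.
have b_gt0 : 0 < b by rewrite addr_gt0// lt_max a0.
have thb y : b <= y -> phi y / y = 0.
  move=> yb; apply/eqP; apply: contraT => /sth0 /andP[_].
  by rewrite leNgt (lt_le_trans _ yb)// ltr_pwDr// le_max lexx orbT.
have [||Theta dTheta Theta0] := @primitive_exists R (fun x => phi x / x) (a / 2).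
- exact: (@continuous_test _ _ 0 tth).
- move=> x xa; apply/eqP; apply: contraT => /sth0; rewrite leNgt.
  by rewrite (le_lt_trans xa)// gtr_pMr// invf_lt1 ?ltr1n.
exists Theta => // d d1.
have d0 : 0 < d by rewrite (lt_le_trans ltr01).
pose th n x := derive1n n (fun x => phi x / x) x.
pose F n t := if n is m.+1 then d ^- n * th m (t / d) - th m t
              else Theta (t / d) - Theta t.
(* Since d >= 1, to the left of a / 2 both t and t / d lie where [Theta] is 0, and to the right of d
   * b both lie where it is constant. *)
apply: (@test_functionP R F (a / 2) (d * b)); first by rewrite divr_gt0.
  case=> [|m] x /=.
    apply: is_derive_sub.
    by rewrite expr1; apply: is_derive_dilation.
  apply: is_derive_sub; last exact: is_derive_test.
  rewrite [d ^+ m.+2]exprSr invfM -mulrA.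
  by apply/is_derive_scale/is_derive_dilation/is_derive_test.
have Thetab x : b <= x -> Theta x = Theta b.
  move=> bx; apply/eqP; rewrite -subr_eq0 -normr_le0.
  rewrite -(mul0r (x - b)).
  apply: (@le_derive_increment R Theta (fun x => phi x / x)) => // y /andP[bY _].
  by rewrite thb// normr0.
move=> x; apply: contra_neqT; rewrite negb_and -!ltNge => /orP[xa|bx].
  rewrite /F /= !Theta0 ?subrr//; first exact: ltW.
  rewrite ler_pdivrMr// (le_trans (ltW xa))// ler_peMr// divr_ge0// ltW//.
rewrite /F /= !Thetab ?subrr//.
  by rewrite (le_trans _ (ltW bx))// ler_peMl// ltW.
by rewrite ler_pdivlMr// mulrC ltW.
Qed.

(** * Hardy operator on compactly supported functions *)

Lemma integral_derivative (R : realType) (F f : R -> R) (u v : R) : u <= v ->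
  (forall x : R, u <= x <= v -> is_derive x 1 F (f x)) ->
  {within `[u, v], continuous f} ->
  (\int[lebesgue_measure]_(x in `[u, v]) (f x)%:E = (F v - F u)%:E)%E.
Proof.
rewrite le_eqVlt => /predU1P[<-|uv] dF cf.
  by rewrite set_itv1 integral_set1 subrr.
have cF := is_derive_within_continuous dF.
rewrite (continuous_FTC2 uv cf (F := F)) ?EFinB//.
  have [cF1 cF2 cF3] := (continuous_within_itvP F uv).1 cF.
  split => // x; rewrite in_itv /= => /andP[ux xv].
  by case: (dF x) => //; rewrite !ltW.
move=> x; rewrite in_itv /= => /andP[ux xv].
have d := dF x; rewrite derive1E; apply: derive_val; apply: d.
by rewrite !ltW.
Qed.

Lemma integral_support (R : realType) (f : R -> R) (A B : set R) :
  A `<=` B -> (forall x, B x -> f x != 0 -> A x) ->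
  \int[lebesgue_measure]_(x in B) f x = \int[lebesgue_measure]_(x in A) f x.
Proof.
move=> AB fA; rewrite Rintegral_mkcond [RHS]Rintegral_mkcond.
congr Rintegral; apply/funext => x; rewrite !patchE.
have [xA|xA] := boolP (x \in A).
  by rewrite mem_set//; apply: AB; rewrite inE in xA.
case: ifPn => // xB; apply/eqP; apply: contraNT xA => fx.
by rewrite inE; apply: fA => //; rewrite inE in xB.
Qed.

(** The form in which atoms, extended by 0, are handled. With u > 0 the weights 1/x, ln x and x^a
    are continuous on [u, v], and plain integrability lets Fubini apply for all q at once. *)
Definition carried_by (R : realType) (b : R -> R) (u v : R) : Prop :=
  [/\ 0 < u, forall x, b x != 0 -> u <= x <= v &
     lebesgue_measure.-integrable setT (EFin \o b)].

Lemma within_continuous_bounded (R : realType) (phi : R -> R) (u v : R) :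
  {within `[u, v], continuous phi} ->
  exists2 M, 0 <= M & forall x, u <= x <= v -> `|phi x| <= M.
Proof.
move=> cphi.
have : bounded_set (phi @` `[u, v]).
  by apply/compact_bounded/continuous_compact => //; exact: segment_compact.
move=> [M [_ hM]]; exists (`|M| + 1); first exact: addr_ge0.
move=> x xuv; apply: (hM (`|M| + 1)); first by rewrite ltr_pwDr// ler_norm.
by exists x => //=; rewrite in_itv.
Qed.

Lemma integrable_carriedM (R : realType) (b phi : R -> R) (u v : R) :
  carried_by b u v -> {within `[u, v], continuous phi} ->
  lebesgue_measure.-integrable setT (EFin \o (fun x => b x * phi x)).
Proof.
move=> [u0 sb ib] cphi.
have -> : EFin \o (fun x => b x * phi x) =
    (fun x => (b x * phi x)%:E) \_ `[u, v].
  apply/funext => x /=; rewrite patchE; case: ifPn => //.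
  rewrite notin_setE /= in_itv /= => nx.
  have -> : b x = 0 by apply/eqP; apply: contraT => /sb /nx.
  by rewrite mul0r.
apply/(integrable_mkcond _ _).1 => //.
have [M M0 hM] := within_continuous_bounded cphi.
have h : lebesgue_measure.-integrable `[u, v] ((EFin \o b) \* (EFin \o phi))%E.
  apply: integrableMl => //.
  - exact: integrableS ib.
  - exact: subspace_continuous_measurable_fun.
  - exists M; split; first exact: num_real.
    move=> N MN x; rewrite /= in_itv /= => xuv.
    by rewrite (le_trans (hM x xuv))// ltW.
exact: h.
Qed.

Lemma pairing_bound (R : realType) (b phi : R -> R) (u v M : R) :
  carried_by b u v -> {within `[u, v], continuous phi} ->
  (forall x, u <= x <= v -> `|phi x| <= M) ->
  `|\int[lebesgue_measure]_x (b x * phi x)| <=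
    M * \int[lebesgue_measure]_x `|b x|.
Proof.
move=> cb cphi hM; have ibphi := integrable_carriedM cb cphi.
have [u0 sb ib] := cb.
rewrite (le_trans (le_normr_Rintegral _ _))//.
have ib' : lebesgue_measure.-integrable setT (EFin \o (fun x => `|b x|)).
  exact: integrable_norm.
rewrite -RintegralZl//; apply: le_Rintegral => //.
- exact: integrable_norm.
- exact: (integrableZl _ _ ib').
move=> x _; rewrite normrM mulrC.
have [->|/sb xuv] := eqVneq (b x) 0; first by rewrite normr0 !mulr0.
by rewrite ler_wpM2r// hM.
Qed.

Lemma EFin_Rintegral (R : realType) (f : R -> R) (D : set R) :
  measurable D -> lebesgue_measure.-integrable D (EFin \o f) ->
  ((\int[lebesgue_measure]_(x in D) f x)%:E =
   \int[lebesgue_measure]_(x in D) (f x)%:E)%E.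
Proof. by move=> mD fi; rewrite fineK//; exact: integrable_fin_num. Qed.

Lemma measurable_within_continuous (R : realType) (phi : R -> R) (u v : R) :
  {within `[u, v], continuous phi} -> measurable_fun setT (phi \_ `[u, v]).
Proof.
move=> cphi; apply/(measurable_restrictT _ _).1 => //.
exact: subspace_continuous_measurable_fun.
Qed.

Lemma integrable_within_continuous (R : realType) (phi : R -> R) (u v : R) :
  {within `[u, v], continuous phi} ->
  lebesgue_measure.-integrable setT (EFin \o (phi \_ `[u, v])).
Proof.
move=> cphi; rewrite -restrict_EFin; apply/(integrable_mkcond _ _).1 => //.
by apply: continuous_compact_integrable => //; exact: segment_compact.
Qed.

Lemma integrable_tensor (R : realType) (f g : R -> R) :
  lebesgue_measure.-integrable setT (EFin \o f) ->
  lebesgue_measure.-integrable setT (EFin \o g) ->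
  (lebesgue_measure \x lebesgue_measure)%E.-integrable setT
    (fun z : R * R => (f z.1 * g z.2)%:E).
Proof.
move=> /integrableP[mf fi] /integrableP[mg gi].
have mf' := (measurable_EFinP _ _).1 mf.
have mg' := (measurable_EFinP _ _).1 mg.
have mfg : measurable_fun setT (fun z : R * R => (f z.1 * g z.2)%:E).
  apply/measurable_EFinP; apply: measurable_funM.
    exact: (measurableT_comp mf').
  exact: (measurableT_comp mg').
apply (@integrable12ltyP _ _ _ _ R lebesgue_measure lebesgue_measure _ mfg).2.
apply: (@le_lt_trans _ _ (\int[lebesgue_measure]_x (`|(f x)%:E| *
    \int[lebesgue_measure]_t `|(g t)%:E|))%E).
  rewrite le_eqVlt; apply/predU1P; left; apply: eq_integral => x _.
  rewrite -ge0_integralZl//; last exact: measurableT_comp.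
  by apply: eq_integral => t _; rewrite /= normrM.
rewrite ge0_integralZr//.
- by apply: lte_mul_pinfty; rewrite ?ge0_fin_numE//; exact: integral_ge0.
- exact: measurableT_comp.
- exact: integral_ge0.
Qed.

(** The integrand theta(x) b(t) on the triangle t < x. Its two iterated integrals are the two sides
    of the duality for H; cutting theta to [u, v] makes it dominated by a product of integrable
    functions. *)
Definition hardy_kernel (R : realType) (b theta : R -> R) (u v : R)
    (z : R * R) : R :=
  (theta \_ `[u, v]) z.1 * (if z.2 < z.1 then b z.2 else 0).

Lemma integrable_hardy_kernel (R : realType) (b theta : R -> R) (u v : R) :
  carried_by b u v -> {within `[u, v], continuous theta} ->
  (lebesgue_measure \x lebesgue_measure)%E.-integrable setT
    (EFin \o hardy_kernel b theta u v).
Proof.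
move=> [u0 sb ib] cth.
have mb : measurable_fun setT b by apply/measurable_EFinP; exact: measurable_int ib.
have mth := measurable_within_continuous cth.
have ith := integrable_within_continuous cth.
apply: le_integrable (integrable_tensor ith ib) => //.
  apply/measurable_EFinP; apply: measurable_funM.
    exact: (measurableT_comp mth).
  apply: measurable_fun_ifT => //; first exact: measurable_fun_ltr.
  exact: (measurableT_comp mb).
move=> z _; rewrite lee_fin !normrM ler_wpM2l//.
by case: ifP => //; rewrite normr0.
Qed.

Lemma hardy_kernelE (R : realType) (b theta : R -> R) (u v x : R) :
  carried_by b u v ->
  (\int[lebesgue_measure]_t (hardy_kernel b theta u v (x, t))%:E =
   ((theta \_ `[u, v]) x * \int[lebesgue_measure]_(t in `]0, x[) b t)%:E)%E.
Proof.
move=> [u0 sb ib].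
have ib0 : lebesgue_measure.-integrable `]0, x[ (EFin \o b).
  exact: integrableS ib.
rewrite EFinM EFin_Rintegral//.
rewrite -(@integralZl _ _ R lebesgue_measure _ _ (EFin \o b))// [RHS]integral_mkcond.
apply: eq_integral => t _; rewrite patchE /hardy_kernel /=.
have [|] := boolP (t \in `]0, x[%classic).
  by rewrite inE /= in_itv /= => /andP[_ ->].
rewrite notin_setE /= in_itv /=.
have [->|/sb /andP[ut _]] := eqVneq (b t) 0; first by rewrite if_same mulr0.
by rewrite (lt_le_trans u0 ut) /= => /negP/negbTE ->; rewrite mulr0.
Qed.

Lemma hardy_kernel_integral1 (R : realType) (b theta Theta : R -> R) (u v t : R) :
  carried_by b u v -> {within `[u, v], continuous theta} ->
  (forall x : R, u <= x <= v -> is_derive x 1 Theta (theta x)) ->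
  (\int[lebesgue_measure]_x (hardy_kernel b theta u v (x, t))%:E =
   (b t * (Theta v - Theta t))%:E)%E.
Proof.
move=> [u0 sb ib] cth dTheta.
have [bt0|/sb /andP[ut tv]] := eqVneq (b t) 0.
  rewrite bt0 mul0r; apply: integral0_eq => x _.
  by rewrite /hardy_kernel /= bt0 if_same mulr0.
have sub : `[t, v] `<=` `[u, v].
  by apply: subset_itvr; rewrite bnd_simp.
have cth' : {within `[t, v], continuous theta} by exact: continuous_subspaceW cth.
have Etv : (\int[lebesgue_measure]_(x in `[t, v]) (theta x)%:E =
    (Theta v - Theta t)%:E)%E.
  apply: integral_derivative => // x /andP[tx xv].
  by apply: dTheta; rewrite xv (le_trans ut).
rewrite EFinM -Etv -integral_itv_obnd_cbnd; last first.
  apply/measurable_EFinP; apply: subspace_continuous_measurable_fun => //.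
  by apply: continuous_subspaceW cth'; exact: subset_itv_oc_cc.
have ith : lebesgue_measure.-integrable `]t, v] (EFin \o theta).
  have h : lebesgue_measure.-integrable `[t, v] (EFin \o theta).
    by apply: continuous_compact_integrable => //; exact: segment_compact.
  by apply: integrableS h => //; exact: subset_itv_oc_cc.
rewrite -(@integralZl _ _ R lebesgue_measure _ _ (EFin \o theta))//.
rewrite [RHS]integral_mkcond; apply: eq_integral => x _.
rewrite /hardy_kernel /= !patchE.
have [tx|xt] := ltP t x.
  have -> : (x \in `]t, v]%classic) = (x \in `[u, v]%classic).
    apply/idP/idP; rewrite !inE /= !in_itv /= => /andP[h1 ->].
      by rewrite (le_trans ut)// ltW.
    by rewrite tx.
  by case: ifPn => _; rewrite ?mul0r// mulrC EFinM.
by rewrite mulr0 memNset//= in_itv /= ltNge xt.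
Qed.

Lemma hardy_supp (R : realType) (b : R -> R) (u v x : R) :
  carried_by b u v -> \int[lebesgue_measure]_t b t = 0 ->
  hardy b x != 0 -> u <= x <= v.
Proof.
move=> [u0 sb ib] b0; apply: contraNT; rewrite negb_and -!ltNge => /orP[xu|vx].
  rewrite /hardy (@integral_support _ _ set0) ?Rintegral_set0 ?mulr0//.
  move=> t; rewrite /= in_itv /= => /andP[_ tx] /sb /andP[ut _].
  by move: tx; rewrite ltNge (le_trans (ltW xu) ut).
rewrite /hardy -(@integral_support _ _ _ setT) ?b0 ?mulr0//.
move=> t _ /sb /andP[ut tv]; rewrite /= in_itv /=.
by rewrite (lt_le_trans u0 ut) (le_lt_trans tv).
Qed.

Lemma integrable_hardy_weighted (R : realType) (b theta : R -> R) (u v : R) :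
  carried_by b u v -> {within `[u, v], continuous theta} ->
  lebesgue_measure.-integrable setT (EFin \o (fun x =>
    (theta \_ `[u, v]) x * \int[lebesgue_measure]_(t in `]0, x[) b t)).
Proof.
move=> cb cth; have := integrable_fubini_F (integrable_hardy_kernel cb cth).
congr (_.-integrable _ _); apply/funext => x.
exact: hardy_kernelE.
Qed.

(** Fubini for [hardy_kernel]. Hardy's inequality uses it with a nonnegative b, and [hardy_duality]
    with a b of mean zero, for which the boundary term [Theta v] disappears. *)
Lemma hardy_weighted_integral (R : realType) (b theta Theta : R -> R) (u v : R) :
  carried_by b u v -> {within `[u, v], continuous theta} ->
  (forall x : R, u <= x <= v -> is_derive x 1 Theta (theta x)) ->
  \int[lebesgue_measure]_x
    ((theta \_ `[u, v]) x * \int[lebesgue_measure]_(t in `]0, x[) b t) =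
  \int[lebesgue_measure]_t (b t * (Theta v - Theta t)).
Proof.
move=> cb cth dTheta.
have := Fubini (integrable_hardy_kernel cb cth).
under eq_integral do rewrite hardy_kernelE//.
under [X in _ = X -> _]eq_integral do rewrite (hardy_kernel_integral1 _ cb cth dTheta).
by move=> h; rewrite /Rintegral h.
Qed.

Lemma hardy_mulE (R : realType) (b theta phi : R -> R) (u v x : R) :
  carried_by b u v -> \int[lebesgue_measure]_t b t = 0 ->
  (forall x, u <= x <= v -> phi x = x * theta x) ->
  hardy b x * phi x =
  (theta \_ `[u, v]) x * \int[lebesgue_measure]_(t in `]0, x[) b t.
Proof.
move=> cb b0 phiE; rewrite patchE.
have [hx|hx] := eqVneq (hardy b x) 0; last first.
  have xuv := hardy_supp cb b0 hx; have /andP[ux xv] := xuv.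
  have x0 : x != 0 by have [u0 _ _] := cb; rewrite gt_eqF// (lt_le_trans u0).
  rewrite mem_set//=.
  by rewrite phiE// /hardy; field.
rewrite hx mul0r; case: ifPn => [|_]; last by rewrite mul0r.
rewrite inE /= in_itv /= => /andP[ux _].
have [u0 _ _] := cb; move: hx => /eqP; rewrite /hardy mulf_eq0 invr_eq0.
by rewrite gt_eqF ?(lt_le_trans u0)//= => /eqP ->; rewrite mulr0.
Qed.

Lemma within_continuous_inv (R : realType) (u v : R) : 0 < u ->
  {within `[u, v], continuous (fun x : R => x^-1)}.
Proof.
move=> u0; apply: (@is_derive_within_continuous _ _ (fun x => - 1%:R * x ^- 2)).
move=> x /andP[ux _]; have x0 : x != 0 by rewrite gt_eqF// (lt_le_trans u0).
exact: (is_derive_exprVn 1 x0).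
Qed.

Lemma carried_by_hardy (R : realType) (b : R -> R) (u v : R) :
  carried_by b u v -> \int[lebesgue_measure]_t b t = 0 ->
  carried_by (hardy b) u v.
Proof.
move=> cb b0; have [u0 sb ib] := cb; split => //.
  by move=> x; exact: hardy_supp.
have := integrable_hardy_weighted cb (@within_continuous_inv R u v u0).
congr (_.-integrable _ _); apply/funext => x /=; congr EFin.
rewrite -(@hardy_mulE _ _ _ (fun=> 1) _ _ _ cb b0) ?mulr1// => y /andP[uy _].
by rewrite divff// gt_eqF// (lt_le_trans u0).
Qed.

(** The adjoint of H integrates phi(x) / x. As b has mean zero, any primitive will do: ln for phi =
    1, a monomial for a monomial of positive degree, the function of [adjoint_primitive] for a test
    function. *)
Lemma hardy_duality (R : realType) (b theta Theta phi : R -> R) (u v : R) :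
  carried_by b u v -> \int[lebesgue_measure]_t b t = 0 ->
  {within `[u, v], continuous theta} ->
  (forall x : R, u <= x <= v -> is_derive x 1 Theta (theta x)) ->
  (forall x, u <= x <= v -> phi x = x * theta x) ->
  \int[lebesgue_measure]_x (hardy b x * phi x) =
  - \int[lebesgue_measure]_t (b t * Theta t).
Proof.
move=> cb b0 cth dTheta phiE.
under eq_Rintegral do rewrite (hardy_mulE _ cb b0 phiE).
rewrite (hardy_weighted_integral cb cth dTheta).
under eq_Rintegral do rewrite mulrBr.
have [u0 sb ib] := cb.
have cTheta := is_derive_within_continuous dTheta.
have ibv : lebesgue_measure.-integrable setT (EFin \o (fun t => b t * Theta v)).
  exact: (integrableZr _ (Theta v) ib).
rewrite RintegralB//; last exact: integrable_carriedM cb cTheta.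
by rewrite RintegralZr// b0 mul0r sub0r.
Qed.

(** * Hardy's inequality *)

Lemma Lnorm_powR (R : realType) (f : R -> R) (r : R) :
  ('N[lebesgue_measure]_r%:E[EFin \o f] =
   (\int[lebesgue_measure]_x (`|f x| `^ r)%:E) `^ r^-1)%E.
Proof. by rewrite unlock. Qed.

Lemma is_derive_powR (R : realType) (a x : R) : 0 < x ->
  is_derive x 1 (fun y => y `^ a) (a * x `^ (a - 1)).
Proof. exact: is_derive1_powR. Qed.

Lemma within_continuous_powR (R : realType) (u v a : R) : 0 < u ->
  {within `[u, v], continuous (fun x : R => x `^ a)}.
Proof.
move=> u0; apply: (@is_derive_within_continuous _ _ (fun x => a * x `^ (a - 1))).
by move=> x /andP[ux _]; apply: is_derive_powR; rewrite (lt_le_trans u0).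
Qed.

(** With c = 1 - 1/r, Hoelder is applied to the factors |b| t^(c/r) and t^(-c/r), with exponents r
    and 1/c. The second factor leads to the integral of t^(c-1), because -1/r = c - 1; it is taken
    from u, where this power is continuous, and the result is then enlarged to x^c / c. *)
Lemma hardy_hoelder (R : realType) (b : R -> R) (u v r x : R) :
  carried_by b u v -> 1 < r ->
  lebesgue_measure.-integrable setT (EFin \o (fun t => `|b t| `^ r)) ->
  u <= x ->
  \int[lebesgue_measure]_(t in `]0, x[) `|b t| <=
  (\int[lebesgue_measure]_(t in `]0, x[) (`|b t| `^ r * t `^ (1 - r^-1))) `^ r^-1 *
  ((1 - r^-1)^-1 * x `^ (1 - r^-1)) `^ (1 - r^-1).
Proof.
move=> cb r1 ibr ux; have [u0 sb ib] := cb.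
have r0 : 0 < r by rewrite (lt_trans ltr01).
have c0 : 0 < 1 - r^-1 by rewrite subr_gt0 invf_lt1.
set c := 1 - r^-1 in c0 *.
have mb : measurable_fun setT b by apply/measurable_EFinP; exact: measurable_int ib.
have cbr : carried_by (fun t => `|b t| `^ r) u v.
  split => // t h; apply: sb; apply: contra_neq h => ->.
  by rewrite normr0 powR0// gt_eqF.
have iB : lebesgue_measure.-integrable setT (EFin \o (fun t => `|b t| `^ r * t `^ c)).
  apply: (integrable_carriedM (phi := fun t => t `^ c) cbr).
  exact: within_continuous_powR.
have inb : lebesgue_measure.-integrable setT (EFin \o (fun t => `|b t|)).
  exact: integrable_norm.
(* The exponent [c / r] of the weight is the one that yields the sharp constant. *)
pose f := (fun t => `|b t| * t `^ (c / r)) \_ `]0, x[.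
pose g := (fun t => t `^ (- (c / r))) \_ `[u, x].
have mf : measurable_fun setT f.
  apply/(measurable_restrictT _ _).1 => //; apply: measurable_funTS.
  apply: measurable_funM; first exact: measurableT_comp.
  exact: measurable_powR.
have mg : measurable_fun setT g.
  apply: measurable_within_continuous; exact: within_continuous_powR.
have := @hoelder _ _ R lebesgue_measure f g r c^-1 mf mg r0.
rewrite invr_gt0 invrK => /(_ c0); rewrite addrC subrK => /(_ erefl).
have -> : ('N[lebesgue_measure]_1[EFin \o (f \* g)%R] =
    (\int[lebesgue_measure]_(t in `]0, x[) `|b t|)%:E)%E.
  rewrite Lnorm1 EFin_Rintegral//; last first.
    exact: integrableS inb.
  rewrite [RHS]integral_mkcond; apply: eq_integral => t _.
  rewrite /= /f /g !patchE.
  have [->|/sb /andP[ut tv]] := eqVneq (b t) 0.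
    by rewrite normr0 mul0r !if_same mul0r normr0.
  have t0 : 0 < t by rewrite (lt_le_trans u0).
  case: ifPn => [|_]; last by rewrite mul0r normr0.
  rewrite inE /= in_itv /= => /andP[_ tx]; rewrite mem_set /=; last first.
    by rewrite in_itv /= ut ltW.
  rewrite -mulrA -powRD; last by rewrite (gt_eqF t0) implybT.
  by rewrite subrr powRr0 mulr1 normr_id.
rewrite !Lnorm_powR invrK.
have -> : (\int[lebesgue_measure]_t (`|f t| `^ r)%:E =
    (\int[lebesgue_measure]_(t in `]0, x[) (`|b t| `^ r * t `^ c))%:E)%E.
  rewrite EFin_Rintegral//; last exact: integrableS iB.
  rewrite [RHS]integral_mkcond; apply: eq_integral => t _.
  rewrite /f !patchE; case: ifPn => tx; last by rewrite normr0 powR0// gt_eqF.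
  rewrite ger0_norm ?mulr_ge0 ?powR_ge0// powRM ?powR_ge0//.
  by rewrite -powRrM divfK// gt_eqF.
have -> : (\int[lebesgue_measure]_t (`|g t| `^ c^-1)%:E =
    (c^-1 * x `^ c - c^-1 * u `^ c)%:E)%E.
  have Eg : (\int[lebesgue_measure]_(t in `[u, x]) (t `^ (c - 1))%:E =
      (c^-1 * x `^ c - c^-1 * u `^ c)%:E)%E.
    apply: (@integral_derivative _ (fun y => c^-1 * y `^ c)) => //.
      move=> y /andP[uy _].
      have h := is_derive_scale c^-1 (@is_derive_powR _ c y (lt_le_trans u0 uy)).
      by apply: (is_derive_eq h); rewrite mulrA mulVf ?mul1r// gt_eqF.
    exact: within_continuous_powR.
  rewrite -Eg [RHS]integral_mkcond; apply: eq_integral => t _.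
  rewrite /g !patchE; case: ifPn => tx; last first.
    by rewrite normr0 powR0// invr_eq0 gt_eqF.
  rewrite ger0_norm ?powR_ge0// -powRrM; congr (_ `^ _)%:E.
  by rewrite mulNr mulrAC divff ?gt_eqF// mul1r /c addrAC subrr sub0r.
rewrite !poweR_EFin -EFinM lee_fin => /le_trans; apply.
rewrite ler_wpM2l ?powR_ge0// ge0_ler_powR ?(ltW c0)//.
- rewrite nnegrE subr_ge0 ler_pM2l ?invr_gt0//.
  by rewrite ge0_ler_powR ?nnegrE ?(ltW c0) ?(ltW u0) ?(le_trans (ltW u0) ux).
- by rewrite nnegrE mulr_ge0 ?powR_ge0// ltW ?invr_gt0.
- by rewrite gerBl mulr_ge0 ?powR_ge0// ltW ?invr_gt0.
Qed.


(** The r-th power of [hardy_hoelder] bounds |Hb|^r by theta(x) times the integral of B over ]0, x[,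
    and Fubini turns this into the integral of B against [Theta v - Theta]. The constant is the r-th
    power of r' = 1 / c. *)
Lemma hardy_inequality (R : realType) (b : R -> R) (u v r : R) :
  carried_by b u v -> \int[lebesgue_measure]_t b t = 0 -> 1 < r ->
  lebesgue_measure.-integrable setT (EFin \o (fun t => `|b t| `^ r)) ->
  (\int[lebesgue_measure]_x (`|hardy b x| `^ r)%:E <=
   ((1 - r^-1) `^ (- r))%:E * \int[lebesgue_measure]_x (`|b x| `^ r)%:E)%E.
Proof.
move=> cb b0 r1 ibr; have [u0 sb ib] := cb.
have r0 : 0 < r by rewrite (lt_trans ltr01).
have c0 : 0 < 1 - r^-1 by rewrite subr_gt0 invf_lt1.
set c := 1 - r^-1 in c0 *.
have cbr : carried_by (fun t => `|b t| `^ r) u v.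
  split => // t h; apply: sb; apply: contra_neq h => ->.
  by rewrite normr0 powR0// gt_eqF.
pose B t := `|b t| `^ r * t `^ c.
have cB : carried_by B u v.
  split => //.
    move=> t h; apply: sb; apply: contra_neq h => bt.
    by rewrite /B bt normr0 powR0 ?mul0r// gt_eqF.
  apply: (integrable_carriedM (phi := fun t => t `^ c) cbr).
  exact: within_continuous_powR.
(* [theta] is x^(-r) (x^c / c)^(c r), simplified by c r = r - 1; [Theta] is a primitive of it. *)
pose theta x := c `^ (- (r - 1)) * x `^ (- c - 1).
pose Theta x := - (c `^ (- r)) * x `^ (- c).
have cth : {within `[u, v], continuous theta}.
  apply: (@is_derive_within_continuous _ _
    (fun x => c `^ (- (r - 1)) * ((- c - 1) * x `^ (- c - 1 - 1)))).
  move=> x /andP[ux _]; apply: is_derive_scale.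
  by apply: is_derive_powR; rewrite (lt_le_trans u0).
have dTheta (x : R) : u <= x <= v -> is_derive x 1 Theta (theta x).
  move=> /andP[ux _].
  have h := @is_derive_powR _ (- c) x (lt_le_trans u0 ux).
  apply: (is_derive_eq (is_derive_scale _ h)).
  rewrite /theta mulrA mulrNN; congr (_ * _).
  rewrite opprB addrC powRD; last by rewrite (gt_eqF c0) implybT.
  by rewrite powRr1// ltW.
have mb : measurable_fun setT (hardy b).
  have [_ _ ih] := carried_by_hardy cb b0.
  by apply/measurable_EFinP; exact: measurable_int ih.
have iw := integrable_hardy_weighted cB cth.
apply: (@le_trans _ _ (\int[lebesgue_measure]_x ((theta \_ `[u, v]) x *
    \int[lebesgue_measure]_(t in `]0, x[) B t)%:E)%E).
  have th0 x : 0 <= (theta \_ `[u, v]) x.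
    by rewrite patchE; case: ifP => // _; rewrite mulr_ge0 ?powR_ge0.
  have mhr : measurable_fun setT (fun x => (`|hardy b x| `^ r)%:E).
    apply/measurable_EFinP.
    by apply: (measurableT_comp (measurable_powR r)); exact: measurableT_comp.
  apply: ge0_le_integral => //.
  - exact: measurable_int iw.
  move=> x _; rewrite lee_fin.
  have [->|hx] := eqVneq (hardy b x) 0.
    rewrite normr0 powR0 ?gt_eqF// mulr_ge0//.
    by apply: Rintegral_ge0 => t _; rewrite mulr_ge0 ?powR_ge0.
  have xuv := hardy_supp cb b0 hx; have /andP[ux xv] := xuv.
  have x0 : 0 < x by rewrite (lt_le_trans u0).
  rewrite patchE mem_set//=.
  rewrite /hardy normrM gtr0_norm ?invr_gt0//.
  have hA : `|\int[lebesgue_measure]_(t in `]0, x[) b t| <=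
      \int[lebesgue_measure]_(t in `]0, x[) `|b t|.
    by apply: le_normr_Rintegral => //; exact: integrableS ib.
  set P := \int[lebesgue_measure]_(t in `]0, x[) B t.
  have hAP : `|\int[lebesgue_measure]_(t in `]0, x[) b t| <=
    P `^ r^-1 * (c^-1 * x `^ c) `^ c := le_trans hA (hardy_hoelder cb r1 ibr ux).
  have P0 : 0 <= P by apply: Rintegral_ge0 => t _; rewrite mulr_ge0 ?powR_ge0.
  apply: (@le_trans _ _ ((x^-1 * (P `^ r^-1 * (c^-1 * x `^ c) `^ c)) `^ r)).
    rewrite ge0_ler_powR ?nnegrE ?(ltW r0) ?mulr_ge0 ?invr_ge0 ?powR_ge0 ?(ltW x0)//.
    by rewrite ler_pM2l ?invr_gt0.
  have rc : c * r = r - 1 by rewrite /c mulrBl mul1r mulVf// gt_eqF.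
  rewrite !powRM ?mulr_ge0 ?powR_ge0 ?invr_ge0 ?(ltW x0) ?(ltW c0)//.
  rewrite -powRrM mulVf ?gt_eqF// powRr1// -!powRrM rc.
  rewrite -!powR_inv1 ?(ltW x0) ?(ltW c0)// -!powRrM !mulN1r -/(theta x) /theta.
  rewrite [X in _ <= X]mulrC (_ : - c - 1 = - r + c * (r - 1)); last first.
    by rewrite mulrBr rc mulr1; ring.
  by rewrite powRD ?(gt_eqF x0) ?implybT// le_eqVlt; apply/orP; left; apply/eqP; ring.
rewrite -EFin_Rintegral// (hardy_weighted_integral cB cth dTheta).
rewrite -EFin_Rintegral// -EFinM lee_fin -RintegralZl//.
apply: le_Rintegral => //.
- apply: (integrable_carriedM (phi := fun t => Theta v - Theta t) cB).
  apply: (@is_derive_within_continuous _ _ (fun t => 0 - theta t)) => x xuv.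
  by apply: is_derive_sub; exact: dTheta.
- exact: (integrableZl _ _ ibr).
move=> t _; rewrite /B.
have [->|/sb /andP[ut tv]] := eqVneq (b t) 0.
  by rewrite normr0 powR0 ?gt_eqF// !mul0r mulr0.
have t0 : 0 < t by rewrite (lt_le_trans u0).
rewrite -mulrA [leRHS]mulrC ler_wpM2l ?powR_ge0// /Theta.
(* [Theta v] is at most 0 and is dropped; the weight t^c of B then cancels the power in
   [Theta t]. *)
apply: (@le_trans _ _ (t `^ c * (c `^ (- r) * t `^ (- c)))).
  by rewrite ler_wpM2l ?powR_ge0// !mulNr opprK gerDr oppr_le0 mulr_ge0 ?powR_ge0.
rewrite mulrCA -powRD; last by rewrite (gt_eqF t0) implybT.
by rewrite subrr powRr0 mulr1.
Qed.

(** * Atoms *)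

Lemma Lnorm_fin_leP (R : realType) (f : R -> R) (r N : R) : 0 < r -> 0 <= N ->
  ('N[lebesgue_measure]_r%:E[EFin \o f] <= N%:E)%E <->
  (\int[lebesgue_measure]_x (`|f x| `^ r)%:E <= (N `^ r)%:E)%E.
Proof.
move=> r0 N0; rewrite Lnorm_powR; set I := (\int[_]_x _)%E.
have I0 : (0 <= I)%E by apply: integral_ge0 => x _; rewrite lee_fin powR_ge0.
have Nr : ((N `^ r)%:E `^ r^-1)%E = N%:E.
  by rewrite poweR_EFin -powRrM divff ?gt_eqF// powRr1.
have Ir : ((I `^ r^-1) `^ r)%E = I by rewrite -poweRrM mulVf ?gt_eqF// poweRe1.
split => h.
  rewrite -Ir -poweR_EFin; apply: gt0_ler_poweR => //; first exact: ltW.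
  - by rewrite in_itv /= poweR_ge0 leey.
  - by rewrite in_itv /= lee_fin N0 leey.
rewrite -Nr; apply: gt0_ler_poweR => //; first by rewrite invr_ge0 ltW.
- by rewrite in_itv /= I0 leey.
- by rewrite in_itv /= lee_fin powR_ge0 leey.
Qed.

Lemma Lnorm_infty_leP (R : realType) (f : R -> R) (N : R) :
  ('N[lebesgue_measure]_+oo[EFin \o f] <= N%:E)%E <->
  {ae lebesgue_measure, forall x, `|f x| <= N}.
Proof.
have muT : (0 < @lebesgue_measure R setT)%E.
  by rewrite -set_itvNyy lebesgue_measure_itv /= addye// ltry.
rewrite unlock muT; split => [/ess_sup_inf.ess_supP h|h].
  move: h; apply: filterS.
  by move=> x; rewrite /= lee_fin.
apply/ess_sup_inf.ess_supP; move: h; apply: filterS.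
  exact: (ae_filter_ringOfSetsType lebesgue_measure).
by move=> x; rewrite /= lee_fin.
Qed.

Lemma closureN (R : realType) (A : set R) (x : R) :
  closure [set - y | y in A] x -> closure A (- x).
Proof.
move=> h U nU; have [|_ [[y Ay <-] Uy]] := h (-%R @^-1` U).
  by exact: (@oppr_continuous R R x U nU).
by exists y; split => //; rewrite /= opprK in Uy.
Qed.

(** The supremum and the infimum of A belong to its closure, hence lie strictly inside the interval;
    the infimum is written as the opposite of a supremum. An empty A, as produced by a zero atom,
    gets the midpoint twice. *)
Lemma closure_in_itv (R : realType) (A : set R) (x0 x1 : R) : x0 < x1 ->
  closure A `<=` `]x0, x1[ ->
  exists u v, [/\ x0 < u, u <= v, v < x1 & forall x, A x -> u <= x <= v].
Proof.
move=> x01 cA; have Aitv x : A x -> x0 < x < x1.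
  by move=> /subset_closure /cA; rewrite /= in_itv.
have [->|/set0P[y Ay]] := eqVneq A set0.
  exists ((x0 + x1) / 2), ((x0 + x1) / 2).
  by split => //; rewrite ?midf_lt.
have ubA : has_ubound A by exists x1 => x /Aitv /andP[_ /ltW].
have ubNA : has_ubound [set - y | y in A].
  by exists (- x0) => _ [x /Aitv /andP[/ltW xx0 _] <-]; rewrite lerN2.
have /cA := closure_sup (ex_intro _ y Ay) ubA; rewrite /= in_itv /= => /andP[_ vx1].
have /closureN/cA : closure [set - y | y in A] (sup [set - y | y in A]).
  by apply: closure_sup => //; exists (- y), y.
rewrite /= in_itv /= => /andP[x0u _].
have hA x : A x -> - sup [set - y | y in A] <= x <= sup A.
  move=> Ax; rewrite (ub_le_sup ubA)// andbT lerNl.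
  by rewrite (ub_le_sup ubNA)//; exists x.
exists (- sup [set - y | y in A]), (sup A); split => //.
by have /andP[h1 h2] := hA y Ay; exact: le_trans h1 h2.
Qed.

(** Hoelder against the indicator of the interval. Combined with the size condition of an atom it
    gives (x1 - x0)^(1 - 1/p), from which q has disappeared. *)
Lemma L1_le_Lq (R : realType) (b : R -> R) (q : \bar R) (x0 x1 N : R) :
  (1 < q)%E -> x0 < x1 -> 0 <= N -> measurable_fun setT b ->
  (forall x, b x != 0 -> x0 <= x <= x1) ->
  ('N[lebesgue_measure]_q[EFin \o b] <= N%:E)%E ->
  (\int[lebesgue_measure]_x `|b x|%:E <=
   (N * (x1 - x0) `^ (1 - fine q^-1))%:E)%E.
Proof.
move=> q1 x01 N0 mb sb; have x10 : 0 < x1 - x0 by rewrite subr_gt0.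
have mI : lebesgue_measure `[x0, x1]%classic = (x1 - x0)%:E.
  by rewrite lebesgue_measure_itv /= lte_fin x01.
case: q q1 => [r| |//]; rewrite ?lte_fin => r1 bN.
  have r0 : 0 < r by rewrite (lt_trans ltr01).
  have c0 : 0 < 1 - r^-1 by rewrite subr_gt0 invf_lt1.
  rewrite inver gt_eqF//= ; set c := 1 - r^-1 in c0 *.
  pose one : R -> R := cst 1; pose g := one \_ `[x0, x1].
  have mg : measurable_fun setT g.
    by apply/(measurable_restrictT _ _).1 => //; exact: measurable_cst.
  have := @hoelder _ _ R lebesgue_measure b g r c^-1 mb mg r0.
  rewrite invr_gt0 invrK => /(_ c0); rewrite addrC subrK => /(_ erefl).
  rewrite Lnorm1 [X in (X <= _)%E -> _](_ : _ =
      (\int[lebesgue_measure]_x `|b x|%:E)%E); last first.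
    apply: eq_integral => x _; rewrite /= /g patchE.
    have [->|/sb xI] := eqVneq (b x) 0; first by rewrite mul0r.
    by rewrite mem_set ?mulr1//= in_itv.
  move=> /le_trans; apply; rewrite EFinM.
  rewrite [X in (_ * X <= _)%E](_ : _ = ((x1 - x0) `^ c)%:E).
    by rewrite lee_wpmul2r// lee_fin powR_ge0.
  rewrite Lnorm_powR invrK -poweR_EFin -mI; congr (_ `^ _)%E.
  rewrite -[RHS]mul1e -integral_cst// [RHS]integral_mkcond.
  apply: eq_integral => x _; rewrite /g !patchE.
  by case: ifPn => _; rewrite ?normr1 ?powR1// normr0 powR0// invr_eq0 gt_eqF.
rewrite invey /= subr0 powRr1 ?(ltW x10)//.
have /Lnorm_infty_leP aeN := bN.
have -> : (\int[lebesgue_measure]_x `|b x|%:E =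
    \int[lebesgue_measure]_(x in `[x0, x1]) `|b x|%:E)%E.
  rewrite [RHS]integral_mkcond; apply: eq_integral => x _; rewrite patchE.
  case: ifPn => //; rewrite notin_setE /= in_itv /= => xI.
  by have [->|/sb /xI//] := eqVneq (b x) 0; rewrite normr0.
rewrite EFinM -mI -integral_cst//; apply: ae_ge0_le_integral => //.
- apply/measurable_EFinP; apply: measurable_funTS; exact: measurableT_comp.
- move: aeN; apply: filterS.
    exact: (ae_filter_ringOfSetsType lebesgue_measure).
  by move=> x h _; rewrite lee_fin.
Qed.

Lemma Lq_le_sup (R : realType) (b : R -> R) (q : \bar R) (x0 x1 S : R) :
  (1 < q)%E -> x0 < x1 -> 0 <= S -> measurable_fun setT b ->
  (forall x, b x != 0 -> x0 <= x <= x1) -> (forall x, `|b x| <= S) ->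
  ('N[lebesgue_measure]_q[EFin \o b] <= (S * (x1 - x0) `^ (fine q^-1))%:E)%E.
Proof.
move=> q1 x01 S0 mb sb bS; have x10 : 0 < x1 - x0 by rewrite subr_gt0.
have mI : lebesgue_measure `[x0, x1]%classic = (x1 - x0)%:E.
  by rewrite lebesgue_measure_itv /= lte_fin x01.
case: q q1 => [r| |//]; rewrite ?lte_fin => r1; last first.
  rewrite invey /= powRr0 mulr1; apply/Lnorm_infty_leP.
  exact: aeW.
have r0 : 0 < r by rewrite (lt_trans ltr01).
rewrite inver gt_eqF//=; apply/Lnorm_fin_leP => //.
  by rewrite mulr_ge0// powR_ge0.
rewrite powRM ?powR_ge0// -powRrM mulVf ?gt_eqF// powRr1 ?(ltW x10)//.
rewrite EFinM -mI -integral_cst// [leRHS]integral_mkcond.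
apply: ge0_le_integral => //.
- apply/measurable_EFinP.
  by apply: (measurableT_comp (measurable_powR r)); exact: measurableT_comp.
- by apply/(measurable_restrictT _ _).1 => //; exact: measurable_cst.
move=> x _; rewrite patchE; case: ifPn => [_|].
  by rewrite lee_fin ge0_ler_powR ?nnegrE// ltW.
rewrite notin_setE /= in_itv /= => xI.
have [->|/sb /xI//] := eqVneq (b x) 0.
by rewrite normr0 powR0// gt_eqF.
Qed.

(** One expression of q' for finite and infinite q; the later constants are all written through 1 -
    1/q. *)
Lemma fine_hoelder_conjugate (R : realType) (q : \bar R) : (1 < q)%E ->
  hoelder_conjugate q = ((1 - fine q^-1)^-1)%:E /\ 0 < 1 - fine q^-1.
Proof.
case: q => [r| |//]; rewrite ?lte_fin => r1.
  have r0 : 0 < r by rewrite (lt_trans ltr01).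
  rewrite inver gt_eqF//= subr_gt0 invf_lt1//; split => //.
  rewrite /hoelder_conjugate /= eqe gt_eqF// -EFinD inver subr_eq0 gt_eqF//.
  by rewrite -EFinM; congr EFin; field; rewrite !gt_eqF//= ?subr_gt0.
by rewrite invey /= subr0 invr1.
Qed.

(** Hardy's inequality with its constant moved to the left. For q = +oo the factor is 1, because
    [hardy b x] is an average of b over ]0, x[. *)
Lemma Lnorm_hardy (R : realType) (b : R -> R) (q : \bar R) (u v N : R) :
  (1 < q)%E -> carried_by b u v -> \int[lebesgue_measure]_t b t = 0 -> 0 <= N ->
  ('N[lebesgue_measure]_q[EFin \o b] <= N%:E)%E ->
  ('N[lebesgue_measure]_q[EFin \o (fun x => (1 - fine q^-1) * hardy b x)%R]
   <= N%:E)%E.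
Proof.
move=> q1 cb b0 N0; have [_ c0] := fine_hoelder_conjugate q1.
have [u0 sb ib] := cb.
have mb : measurable_fun setT b by apply/measurable_EFinP; exact: measurable_int ib.
case: q q1 c0 => [r| |//]; rewrite ?lte_fin => r1.
  have r0 : 0 < r by rewrite (lt_trans ltr01).
  rewrite inver gt_eqF//=; set c := 1 - r^-1 => c0.
  move=> /(Lnorm_fin_leP _ r0 N0) bN; apply/Lnorm_fin_leP => //.
  have ibr : lebesgue_measure.-integrable setT (EFin \o (fun t => `|b t| `^ r)).
    apply/integrableP; split.
      apply/measurable_EFinP.
      by apply: (measurableT_comp (measurable_powR r)); exact: measurableT_comp.
    under eq_integral do rewrite gee0_abs ?lee_fin ?powR_ge0//.
    by rewrite (le_lt_trans bN)// ltry.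
  have := hardy_inequality cb b0 r1 ibr; rewrite -/c => h.
  have mh : measurable_fun setT (hardy b).
    have [_ _ ih] := carried_by_hardy cb b0.
    by apply/measurable_EFinP; exact: measurable_int ih.
  under eq_integral do rewrite normrM powRM// (gtr0_norm c0) EFinM.
  have mhr : measurable_fun setT (fun x => (`|hardy b x| `^ r)%:E).
    apply/measurable_EFinP.
    by apply: (measurableT_comp (measurable_powR r)); exact: measurableT_comp.
  have h0 x : setT x -> (0 <= (`|hardy b x| `^ r)%:E)%E.
    by rewrite lee_fin powR_ge0.
  rewrite ge0_integralZl_EFin ?powR_ge0//.
  apply: (@le_trans _ _ ((c `^ r)%:E * ((c `^ (- r))%:E *
    \int[lebesgue_measure]_x (`|b x| `^ r)%:E))%E).
    by rewrite lee_wpmul2l// lee_fin powR_ge0.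
  rewrite muleA -EFinM -powRD; last by rewrite (gt_eqF c0) implybT.
  by rewrite subrr powRr0 mul1e.
rewrite invey /= subr0 => _ /Lnorm_infty_leP aeN; apply/Lnorm_infty_leP.
apply: aeW => x; rewrite mul1r.
have [->|hx] := eqVneq (hardy b x) 0; first by rewrite normr0.
have /andP[ux _] := hardy_supp cb b0 hx.
have x0 : 0 < x by rewrite (lt_le_trans u0).
rewrite /hardy normrM gtr0_norm ?invr_gt0// mulrC ler_pdivrMr//.
have ib0 : lebesgue_measure.-integrable `]0, x[ (EFin \o b) by exact: integrableS ib.
rewrite (le_trans (le_normr_Rintegral _ ib0))//.
rewrite -lee_fin EFin_Rintegral//; last exact: integrable_norm.
have mI : lebesgue_measure `]0, x[%classic = x%:E.
  by rewrite lebesgue_measure_itv /= lte_fin x0 sube0.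
rewrite EFinM -mI -integral_cst//; apply: ae_ge0_le_integral => //.
- by apply/measurable_EFinP; apply: measurable_funTS; exact: measurableT_comp.
- move: aeN; apply: filterS.
    exact: (ae_filter_ringOfSetsType lebesgue_measure).
  by move=> t h _; rewrite lee_fin.
Qed.

Lemma restrict_Rplus_mul (R : realType) (a phi : R -> R) :
  \int[lebesgue_measure]_(x in @Rplus R) (a x * phi x) =
  \int[lebesgue_measure]_x ((a \_ (@Rplus R)) x * phi x).
Proof.
rewrite Rintegral_mkcond; apply: eq_Rintegral => x _; rewrite !patchE.
by case: ifP => // _; rewrite mul0r.
Qed.

Lemma restrict_Rplus_carried (R : realType) (b : R -> R) (u v : R) :
  carried_by b u v -> b \_ (@Rplus R) = b.
Proof.
move=> [u0 sb _]; apply/funext => x; rewrite patchE; case: ifPn => //.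
rewrite notin_setE /Rplus /= in_itv /= andbT => x0.
have [->//|/sb /andP[ux _]] := eqVneq (b x) 0.
by exfalso; apply: x0; rewrite (lt_le_trans u0).
Qed.

Lemma hardy_restrict (R : realType) (a : R -> R) :
  hardy (a \_ (@Rplus R)) = hardy a.
Proof.
apply/funext => x; rewrite /hardy; congr (_ * _); apply: eq_Rintegral => t.
rewrite inE /= in_itv /= => /andP[t0 _]; rewrite patchE mem_set//.
by rewrite /Rplus /= in_itv /= t0.
Qed.

(** Two intervals are kept: ]x0, x1[ governs the size condition and is inherited by Ha, while the
    compact [u, v] inside it is where weights and test functions are continuous and bounded. *)
Lemma atom_carried (R : realType) (p : R) (q : \bar R) (s : nat) (a : R -> R) :
  (1 < q)%E -> atom p q s a ->
  exists x0 x1 u v, [/\ 0 < x0 < u, u <= v < x1,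
    carried_by (a \_ (@Rplus R)) u v,
    ('N[lebesgue_measure]_q[EFin \o a \_ (@Rplus R)] <=
      ((x1 - x0) `^ (fine q^-1 - p^-1))%:E)%E &
    forall beta, (beta <= s)%N ->
      \int[lebesgue_measure]_x ((a \_ (@Rplus R)) x * x ^+ beta) = 0].
Proof.
move=> q1 [ma [[x0 [x1 [x00 x01 /(closure_in_itv x01)[u [v [x0u uv vx1 suv]]] aN]]] mom]].
exists x0, x1, u, v; rewrite /LqRplus_norm restrict_EFin in aN.
have mb : measurable_fun setT (a \_ (@Rplus R)).
  by apply/(measurable_restrictT _ _).1 => //; exact: measurable_itv.
have sb x : (a \_ (@Rplus R)) x != 0 -> u <= x <= v.
  rewrite patchE; case: ifPn => [|_]; last by rewrite eqxx.
  by rewrite inE => Rx ax; apply: suv.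
split => //.
- by rewrite x00.
- by rewrite uv.
- split => //; first by rewrite (lt_trans x00).
  apply/integrableP; split; first exact/measurable_EFinP.
  apply: le_lt_trans (L1_le_Lq q1 x01 (powR_ge0 _ _) mb _ aN) _.
    by move=> x /sb /andP[ux xv]; rewrite (ltW (lt_le_trans x0u ux)) (ltW (le_lt_trans xv vx1)).
  by rewrite ltry.
- by move=> beta /mom; rewrite restrict_Rplus_mul.
Qed.

Lemma carried_atom (R : realType) (p : R) (q : \bar R) (s : nat) (b : R -> R)
    (x0 x1 u v : R) : 0 < x0 < u -> u <= v < x1 -> carried_by b u v ->
  ('N[lebesgue_measure]_q[EFin \o b] <=
    ((x1 - x0) `^ (fine q^-1 - p^-1))%:E)%E ->
  (forall beta, (beta <= s)%N ->
    \int[lebesgue_measure]_x (b x * x ^+ beta) = 0) ->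
  atom p q s b.
Proof.
move=> /andP[x00 x0u] /andP[uv vx1] cb bN mom; have [u0 sb ib] := cb.
split; last split.
- apply: measurable_funTS; apply/measurable_EFinP; exact: measurable_int ib.
- exists x0, x1; split => //.
  + by rewrite (lt_trans x0u)// (le_lt_trans uv).
  + apply: (@subset_trans _ `[u, v]); last first.
      by move=> x /=; rewrite !in_itv /= => /andP[ux xv]; rewrite (lt_le_trans x0u)// (le_lt_trans xv).
    have /closure_id -> : closed `[u, v]%classic by exact: interval_closed.
    by apply: closure_subset => x [_ /sb]; rewrite /= in_itv.
  + by rewrite /LqRplus_norm restrict_EFin (restrict_Rplus_carried cb).
- by move=> beta /mom; rewrite restrict_Rplus_mul (restrict_Rplus_carried cb).
Qed.

(** The adjoint of H multiplies a positive power by a constant, so vanishing moments of positive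
    order are inherited. *)
Lemma hardy_moment (R : realType) (b : R -> R) (u v : R) (n : nat) :
  carried_by b u v -> \int[lebesgue_measure]_t b t = 0 ->
  \int[lebesgue_measure]_x (hardy b x * x ^+ n.+1) =
  - \int[lebesgue_measure]_t (b t * (n.+1%:R^-1 * t ^+ n.+1)).
Proof.
move=> cb b0; apply: (@hardy_duality _ b (fun x => x ^+ n) _ _ u v) => //.
- apply: (@is_derive_within_continuous _ _ (fun x => n%:R * x ^+ n.-1)) => x _.
  exact: is_derive_exprn.
- move=> x _; apply: (is_derive_eq (is_derive_scale _ (is_derive_exprn _ _))).
  by rewrite mulrA mulVf ?mul1r// pnatr_eq0.
- by move=> x _; rewrite exprS.
Qed.

(** The weight 1 is carried to a primitive of 1/x: this is where the cancellation against ln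
    enters. *)
Lemma hardy_moment0 (R : realType) (b : R -> R) (u v : R) :
  carried_by b u v -> \int[lebesgue_measure]_t b t = 0 ->
  \int[lebesgue_measure]_x (hardy b x * 1) =
  - \int[lebesgue_measure]_t (b t * ln t).
Proof.
move=> cb b0; have [u0 _ _] := cb.
apply: (@hardy_duality _ b (fun x => x^-1) _ (cst 1) u v) => //.
- exact: within_continuous_inv.
- by move=> x /andP[ux _]; apply: is_derive1_ln; rewrite (lt_le_trans u0).
- by move=> x /andP[ux _]; rewrite divff// gt_eqF// (lt_le_trans u0).
Qed.

Lemma hardy_atom (R : realType) (p : R) (q : \bar R) (s : nat) (a : R -> R) :
  (1 < q)%E -> Latom p q s a ->
  atom p q s (fun x => (1 - fine q^-1) * hardy a x).
Proof.
move=> q1 [/(atom_carried q1)[x0 [x1 [u [v [x0u vx1 cb bN mom]]]]]].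
rewrite -hardy_restrict restrict_Rplus_mul; set b := a \_ _ in cb bN mom *.
move=> lnb; set c := 1 - fine q^-1.
have b0 : \int[lebesgue_measure]_t b t = 0.
  by rewrite -[RHS](mom 0%N)//; apply: eq_Rintegral => x _; rewrite expr0 mulr1.
have ch := carried_by_hardy cb b0; have [u0 sh ih] := ch.
apply: (carried_atom x0u vx1).
- split => //; last exact: (integrableZl _ _ ih).
  by move=> x; rewrite mulf_eq0 negb_or => /andP[_]; exact: sh.
- exact: (Lnorm_hardy q1 cb b0 (powR_ge0 _ _) bN).
have cX m : {within `[u, v], continuous (fun x : R => x ^+ m)}.
  apply: (@is_derive_within_continuous _ _ (fun x => m%:R * x ^+ m.-1)) => x _.
  exact: is_derive_exprn.
move=> beta hbeta; under eq_Rintegral do rewrite -mulrA.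
rewrite RintegralZl//; last exact: integrable_carriedM ch (cX _).
case: beta hbeta => [_|n ns].
  by under eq_Rintegral do rewrite expr0; rewrite (hardy_moment0 cb b0) lnb oppr0 mulr0.
rewrite (hardy_moment _ cb b0); under eq_Rintegral do rewrite mulrCA.
rewrite RintegralZl//; last exact: integrable_carriedM cb (cX _).
by rewrite mom// mulr0 oppr0 mulr0.
Qed.

(** * The case 1/p <= s + 2 *)

Lemma continuous_big_sum (R : realType) (K : nat -> R -> R) (c : nat -> R)
    (n : nat) : (forall j, continuous (K j)) ->
  continuous (fun x => \sum_(j < n) c j * K j x).
Proof.
move=> cK; elim: n => [|n ih].
  under eq_fun do rewrite big_ord0; exact: cst_continuous.
under eq_fun do rewrite big_ord_recr/=.
move=> x; apply: cvgD; first exact: ih.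
by apply: cvgM; [exact: cvg_cst|exact: cK].
Qed.

Lemma pairing_sum (R : realType) (b : R -> R) (K : nat -> R -> R) (c : nat -> R)
    (u v : R) (n : nat) :
  carried_by b u v -> (forall j, continuous (K j)) ->
  \int[lebesgue_measure]_x (b x * \sum_(j < n) c j * K j x) =
  \sum_(j < n) c j * \int[lebesgue_measure]_x (b x * K j x).
Proof.
move=> cb cK; elim: n => [|n ih].
  under eq_Rintegral do rewrite big_ord0 mulr0.
  by rewrite big_ord0 Rintegral_cst// mul0r.
under eq_Rintegral do rewrite big_ord_recr/= mulrDr [X in _ + X]mulrCA.
have ibK := integrable_carriedM cb (continuous_subspaceT (cK n)).
rewrite RintegralD//.
- by rewrite RintegralZl// ih big_ord_recr.
- apply: integrable_carriedM cb _; apply: continuous_subspaceT.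
  exact: continuous_big_sum.
- exact: (integrableZl _ _ ibK).
Qed.

Lemma moment_poly (R : realType) (b : R -> R) (c : nat -> R) (u v : R) (n : nat) :
  carried_by b u v ->
  (forall beta, (beta < n)%N -> \int[lebesgue_measure]_x (b x * x ^+ beta) = 0) ->
  \int[lebesgue_measure]_x (b x * \sum_(i < n) c i * x ^+ i) = 0.
Proof.
move=> cb mom; rewrite (pairing_sum (K := fun i x => x ^+ i) _ _ cb).
  by rewrite big1// => i _; rewrite mom ?mulr0.
by move=> j; exact: exprn_continuous.
Qed.

(** Let l = x1 - x0. If l >= 1, the L^1 norm l^(1 - 1/p) is at most 1, because 1/p >= 1. If l < 1, a
    polynomial of degree s is subtracted from phi, which leaves at most M l^(s+1); the exponent s +
    2 - 1/p of the product is nonnegative. *)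
Lemma atom_pairing_bound (R : realType) (p : R) (q : \bar R) (s : nat)
    (a phi : R -> R) (M : R) :
  0 < p -> p <= 1 -> (1 < q)%E -> p^-1 <= s.+2%:R -> atom p q s a ->
  test_function phi -> (forall x, `|phi x| <= M) ->
  (forall x, `|derive1n s.+1 phi x| <= M) ->
  `|integrate_against a phi| <= M.
Proof.
move=> p0 p1 q1 ps aa tphi M0 Ms; rewrite /integrate_against restrict_Rplus_mul.
have [x0 [x1 [u [v [/andP[x00 x0u] /andP[uv vx1] cb bN mom]]]]] := atom_carried q1 aa.
set b := a \_ _ in cb bN mom *; have [u0 sb ib] := cb.
have x01 : x0 < x1 by rewrite (lt_trans x0u)// (le_lt_trans uv).
have I0 : 0 < x1 - x0 by rewrite subr_gt0.
have MM : 0 <= M by rewrite (le_trans _ (M0 0)).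
have mb : measurable_fun setT b by apply/measurable_EFinP; exact: measurable_int ib.
have L1 : \int[lebesgue_measure]_x `|b x| <= (x1 - x0) `^ (1 - p^-1).
  rewrite -lee_fin EFin_Rintegral//; last exact: integrable_norm.
  apply: le_trans (L1_le_Lq q1 x01 (powR_ge0 _ _) mb _ bN) _.
    by move=> x /sb /andP[ux xv]; rewrite (ltW (lt_le_trans x0u ux)) (ltW (le_lt_trans xv vx1)).
  rewrite lee_fin -powRD; last by rewrite (gt_eqF I0) implybT.
  by rewrite (_ : _ - _ + _ = 1 - p^-1)//; ring.
have cphi : {within `[u, v], continuous phi}.
  by apply: continuous_subspaceT; exact: (@continuous_test _ _ 0 tphi).
have [I1|I1] := leP 1 (x1 - x0).
  apply: le_trans (pairing_bound cb cphi (fun x _ => M0 x)) _.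
  rewrite -[leRHS]mulr1 ler_wpM2l// (le_trans L1)//.
  apply: (@le_trans _ _ ((x1 - x0) `^ 0)); last by rewrite powRr0.
  apply: ler_powR => //; rewrite subr_le0.
  by rewrite -[leLHS]invr1 lef_pV2 ?posrE.
have [||c hc'] := @poly_approx R u v (M * (v - u)) (derive1n s phi u) s
  (fun i => derive1n i phi) uv.
- by move=> i x _ _; exact: is_derive_test.
- move=> x /andP[ux xv]; apply: (@le_trans _ _ (M * (x - u))).
    apply: (@le_derive_increment _ _ (derive1n s.+1 phi)) => // y _.
    exact: is_derive_test.
  by rewrite ler_wpM2l// lerB.
have hc x : u <= x <= v ->
    `|phi x - \sum_(i < s.+1) c i * x ^+ i| <= M * (v - u) ^+ s.+1.
  by move=> /hc'; rewrite -mulrA -exprS.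
pose P x := \sum_(i < s.+1) c i * x ^+ i.
have cP : {within `[u, v], continuous P}.
  apply: (@is_derive_within_continuous _ _
    (fun x => \sum_(i < s.+1) c i * (i%:R * x ^+ i.-1))) => x _.
  exact: is_derive_monomial_sum.
have cd : {within `[u, v], continuous (fun x => phi x - P x)}.
  apply: (@is_derive_within_continuous _ _
    (fun x => derive1n 1 phi x - \sum_(i < s.+1) c i * (i%:R * x ^+ i.-1))) => x _.
  apply: is_derive_sub; first exact: (@is_derive_test _ _ 0).
  exact: is_derive_monomial_sum.
have -> : \int[lebesgue_measure]_x (b x * phi x) =
    \int[lebesgue_measure]_x (b x * (phi x - P x)).
  under [RHS]eq_Rintegral do rewrite mulrBr.
  rewrite RintegralB//; last 2 first.
  - exact: integrable_carriedM cb cphi.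
  - exact: integrable_carriedM cb cP.
  by rewrite [X in _ - X](moment_poly _ cb) ?subr0.
apply: le_trans (pairing_bound cb cd hc) _.
rewrite -mulrA -[leRHS]mulr1 ler_wpM2l//.
apply: (@le_trans _ _ ((x1 - x0) `^ s.+1%:R * (x1 - x0) `^ (1 - p^-1))).
  apply: ler_pM => //; rewrite ?exprn_ge0 ?subr_ge0//.
    by apply: Rintegral_ge0.
  rewrite powR_mulrn ?(ltW I0)// ler_pXn2r// ?nnegrE ?subr_ge0// ?(ltW x01)//.
  by rewrite lerB// ltW.
rewrite -powRD; last by rewrite (gt_eqF I0) implybT.
apply: (@le_trans _ _ ((x1 - x0) `^ 0)); last by rewrite powRr0.
apply: ger_powR; first by rewrite I0 ltW.
by rewrite addrA subr_ge0 natr1.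
Qed.

(** As p <= 1, a nonzero |lam k| splits as |lam k|^(1-p) |lam k|^p, and the first factor is bounded
    because no term exceeds the sum S. *)
Lemma summable_of_powR (R : realType) (p : R) (lam : nat -> R) :
  0 < p -> p <= 1 -> cvgn (series (fun k => `|lam k| `^ p)) ->
  cvgn (series (fun k => `|lam k|)).
Proof.
move=> p0 p1 cv; set S := limn (series (fun k => `|lam k| `^ p)).
have leS k : `|lam k| `^ p <= S.
  apply: (@le_trans _ _ (series (fun k => `|lam k| `^ p) k.+1)).
    by rewrite /series /= big_nat_recr//= lerDr sumr_ge0// => i _; exact: powR_ge0.
  apply: nondecreasing_cvgn_le => //.
  by apply: nondecreasing_series => i _ _; exact: powR_ge0.
have lek k : `|lam k| <= S `^ p^-1.
  have S0 : 0 <= S by exact: le_trans (powR_ge0 _ _) (leS 0%N).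
  have -> : `|lam k| = (`|lam k| `^ p) `^ p^-1.
    by rewrite -powRrM divff ?gt_eqF// powRr1.
  by rewrite ge0_ler_powR ?nnegrE ?invr_ge0 ?powR_ge0// ltW.
apply: (@series_le_cvg _ _ (fun k => (S `^ p^-1) `^ (1 - p) * `|lam k| `^ p)) => //.
- by move=> n; rewrite mulr_ge0 ?powR_ge0.
- move=> n; have [->|l0] := eqVneq (lam n) 0.
    by rewrite normr0 mulr_ge0 ?powR_ge0.
  rewrite -{1}[`|lam n|]powRr1// -[X in _ `^ X](subrK p).
  rewrite powRD; last by rewrite normr_eq0 l0 implybT.
  by rewrite ler_wpM2r ?powR_ge0// ge0_ler_powR ?nnegrE ?subr_ge0 ?powR_ge0.
have := @is_cvg_seriesZ _ _ ((S `^ p^-1) `^ (1 - p)) cv.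
by congr (cvgn (series _)).
Qed.

Lemma eventually_all_below (P : nat -> nat -> Prop) (K : nat) :
  (forall k, exists D, forall d, (D <= d)%N -> P d k) ->
  exists D, forall d k, (D <= d)%N -> (k < K)%N -> P d k.
Proof.
move=> h; elim: K => [|K [D hD]]; first by exists 0%N.
have [E hE] := h K; exists (maxn D E) => d k; rewrite geq_max => /andP[Dd Ed].
by rewrite ltnS leq_eqVlt => /predU1P[->|kK]; [exact: hE|exact: hD].
Qed.

(** Dominated convergence for series whose terms are each eventually 0: the first K terms vanish
    simultaneously for large d, and the tail is small uniformly in d. *)
Lemma tannery_zero (R : realType) (w : nat -> R) (t : nat -> nat -> R) (C : R)
    (L : nat -> R) :
  cvgn (series (fun k => `|w k|)) -> (forall d k, `|t d k| <= C) ->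
  (forall k, exists D, forall d, (D <= d)%N -> t d k = 0) ->
  (forall d, series (fun k => w k * t d k) @ \oo --> L d) ->
  L @ \oo --> 0.
Proof.
move=> cw tC t0 tL; apply/cvgrPdist_le => e e0.
have C0 : 0 <= C by exact: le_trans (normr_ge0 _) (tC 0%N 0%N).
have C1 : 0 < C + 1 by rewrite ltr_wpDl.
have eC0 : 0 < e / (C + 1) by exact: divr_gt0.
set S := limn (series (fun k => `|w k|)).
have leS n : series (fun k => `|w k|) n <= S.
  by apply: nondecreasing_cvgn_le => //; exact: nondecreasing_series.
have [K _ hK] : \forall n \near \oo, `|S - series (fun k => `|w k|) n| <= e / (C + 1).
  by move/cvgrPdist_le : cw; exact.
have [D hD] := @eventually_all_below (fun d k => t d k = 0) K t0.
exists D => // d Dd; rewrite /= sub0r normrN.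
have cn : `|series (fun k => w k * t d k) x| @[x --> \oo] --> `|L d|.
  exact: cvg_norm (tL d).
rewrite -(cvg_lim (@Rhausdorff R) cn); apply: limr_le; first exact: cvgP cn.
exists K => // n /= Kn.
have -> : series (fun k => w k * t d k) n = \sum_(K <= k < n) w k * t d k.
  rewrite /series /= (big_cat_nat (n := K))//= big1_seq ?add0r// => k.
  by rewrite mem_index_iota => /andP[_ kK]; rewrite hD// mulr0.
apply: (@le_trans _ _ ((C + 1) * \sum_(K <= k < n) `|w k|)).
  rewrite (le_trans (ler_norm_sum _ _ _))// mulr_sumr; apply: ler_sum => k _.
  rewrite normrM mulrC ler_wpM2r// (le_trans (tC _ _))// lerDl//.
rewrite -ler_pdivlMl// mulrC.
have -> : \sum_(K <= k < n) `|w k| =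
    series (fun k => `|w k|) n - series (fun k => `|w k|) K.
  by rewrite /series /= [in RHS](big_cat_nat (n := K))//= addrAC subrr add0r.
have := hK K (leqnn K); rewrite ger0_norm ?subr_ge0//; apply: le_trans.
by rewrite lerB.
Qed.

Lemma Latom_hardy_carried (R : realType) (p : R) (q : \bar R) (s : nat) (a : R -> R) :
  (1 < q)%E -> Latom p q s a ->
  exists u v, [/\ u <= v, carried_by (a \_ (@Rplus R)) u v,
    \int[lebesgue_measure]_x (a \_ (@Rplus R)) x = 0 & carried_by (hardy a) u v].
Proof.
move=> q1 [/(atom_carried q1)[x0 [x1 [u [v [x0u /andP[uv vx1] cb bN mom]]]]] _].
have b0 : \int[lebesgue_measure]_t (a \_ (@Rplus R)) t = 0.
  by rewrite -[RHS](mom 0%N)//; apply: eq_Rintegral => x _; rewrite expr0 mulr1.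
by exists u, v; split => //; rewrite -hardy_restrict; exact: carried_by_hardy.
Qed.

Lemma test_within_continuous (R : realType) (phi : R -> R) (u v : R) :
  test_function phi -> {within `[u, v], continuous phi}.
Proof.
move=> tphi; apply: continuous_subspaceT; exact: (@continuous_test _ _ 0 tphi).
Qed.

Lemma integrate_against_carried (R : realType) (b phi : R -> R) (u v : R) :
  carried_by b u v ->
  integrate_against b phi = \int[lebesgue_measure]_x (b x * phi x).
Proof.
by move=> cb; rewrite /integrate_against restrict_Rplus_mul (restrict_Rplus_carried cb).
Qed.

Lemma carried_scale (R : realType) (b : R -> R) (c u v : R) :
  carried_by b u v -> carried_by (fun x => c * b x) u v.
Proof.
move=> [u0 sb ib]; split => //; last exact: (integrableZl _ _ ib).
by move=> x; rewrite mulf_eq0 negb_or => /andP[_]; exact: sb.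
Qed.

Lemma integrate_against_scale (R : realType) (b phi : R -> R) (c u v : R) :
  carried_by b u v -> test_function phi ->
  integrate_against (fun x => c * b x) phi = c * integrate_against b phi.
Proof.
move=> cb tphi; rewrite (integrate_against_carried _ cb).
rewrite (integrate_against_carried _ (carried_scale c cb)).
under eq_Rintegral do rewrite -mulrA.
rewrite RintegralZl//; apply: integrable_carriedM cb _.
exact: test_within_continuous.
Qed.

Lemma hardy_pairing_bound (R : realType) (p : R) (q : \bar R) (s : nat)
    (a phi : R -> R) (M : R) :
  0 < p -> p <= 1 -> (1 < q)%E -> p^-1 <= s.+2%:R -> Latom p q s a ->
  test_function phi -> (forall x, `|phi x| <= M) ->
  (forall x, `|derive1n s.+1 phi x| <= M) ->
  `|integrate_against (hardy a) phi| <= (1 - fine q^-1)^-1 * M.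
Proof.
move=> p0 p1 q1 ps La tphi M0 Ms; have [_ c0] := fine_hoelder_conjugate q1.
have [u [v [_ _ _ ch]]] := Latom_hardy_carried q1 La.
have := atom_pairing_bound p0 p1 q1 ps (hardy_atom q1 La) tphi M0 Ms.
rewrite (integrate_against_scale _ ch tphi) normrM gtr0_norm//.
by rewrite ler_pdivlMl.
Qed.

(** The measure dx / x is invariant under dilations, so [Theta (t / d)] is a primitive of
    [dilate d phi x / x], and [hardy_duality] applies to both terms. *)
Lemma hardy_pairing_dilate (R : realType) (p : R) (q : \bar R) (s : nat)
    (a phi Theta : R -> R) (d : R) :
  (1 < q)%E -> Latom p q s a -> test_function phi -> 0 < d ->
  (forall x : R, is_derive x 1 Theta (phi x / x)) ->
  integrate_against (hardy a) phi - integrate_against (hardy a) (dilate d phi) =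
  integrate_against a (fun t => Theta (t / d) - Theta t).
Proof.
move=> q1 La tphi d0 dTheta.
have [u [v [_ cb b0 ch]]] := Latom_hardy_carried q1 La.
have [u0 _ _] := cb.
rewrite !(integrate_against_carried _ ch) -(hardy_restrict a).
have xE (psi : R -> R) x : u <= x <= v -> psi x = x * (psi x / x).
  by move=> /andP[ux _]; rewrite mulrC divfK// gt_eqF// (lt_le_trans u0).
rewrite (@hardy_duality _ _ (fun x => phi x / x) Theta phi u v)//; last 2 first.
- exact: test_within_continuous (test_function_div tphi).
- exact: xE.
have tphid := test_function_dilate d0 tphi.
have dThetad (x : R) : is_derive x 1 (fun t => Theta (t / d)) (dilate d phi x / x).
  apply: (is_derive_eq (is_derive_dilation (dTheta (x / d)))).
  rewrite /dilate invfM invrK [in LHS]mulrCA; congr (_ * _).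
  by rewrite mulrCA mulVf ?mulr1// gt_eqF.
rewrite (@hardy_duality _ _ (fun x => dilate d phi x / x)
  (fun t => Theta (t / d)) (dilate d phi) u v)//; last 2 first.
- exact: test_within_continuous (test_function_div tphid).
- exact: xE.
rewrite opprK addrC /integrate_against restrict_Rplus_mul.
under [RHS]eq_Rintegral do rewrite mulrBr.
rewrite RintegralB//.
- apply: (integrable_carriedM (phi := fun t => Theta (t / d)) cb).
  exact: is_derive_within_continuous.
- apply: (integrable_carriedM (phi := Theta) cb).
  exact: is_derive_within_continuous.
Qed.

Lemma hardy_pairing_far (R : realType) (p : R) (q : \bar R) (s : nat)
    (a phi : R -> R) : (1 < q)%E -> Latom p q s a -> test_function phi ->
  exists D, forall d, (D <= d)%N ->
    integrate_against (hardy a) (dilate d.+1%:R phi) = 0.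
Proof.
move=> q1 La [_ [l [r [l0 sphi]]]].
have [u [v [_ _ _ ch]]] := Latom_hardy_carried q1 La; have [u0 sh _] := ch.
(* From this index on, the dilated phi is supported beyond (d + 1) l > v, where [hardy a]
   vanishes. *)
exists (Num.truncn (v / l)) => d hd; rewrite (integrate_against_carried _ ch).
under eq_Rintegral.
  move=> x _; rewrite (_ : hardy a x * _ = 0); last first.
    have [->|/sh /andP[ux xv]] := eqVneq (hardy a x) 0; first by rewrite mul0r.
    have [->|/sphi /andP[lx _]] := eqVneq (dilate d.+1%:R phi x) 0.
      by rewrite mulr0.
    exfalso; move: lx; rewrite ler_pdivlMr// => ldx.
    have := le_trans ldx xv; rewrite mulrC -ler_pdivlMr//.
    rewrite leNgt => /negP; apply.
    by rewrite (lt_le_trans (truncnS_gt _))// ler_nat ltnS.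
  over.
by rewrite Rintegral_cst// mul0r.
Qed.

Lemma cvg_series_bounded (R : realType) (w t : nat -> R) (C : R) :
  cvgn (series (fun k => `|w k|)) -> (forall k, `|t k| <= C) ->
  cvgn (series (fun k => w k * t k)).
Proof.
move=> cw tC; apply: normed_cvg.
have C0 : 0 <= C by exact: le_trans (normr_ge0 _) (tC 0%N).
apply: (@series_le_cvg _ _ (fun k => C * `|w k|)) => //.
- by move=> n; exact: normr_ge0.
- by move=> n; rewrite mulr_ge0.
- by move=> n; rewrite /= normrM mulrC ler_wpM2r.
have := @is_cvg_seriesZ _ _ C cw.
by congr (cvgn (series _)).
Qed.

(** Gives the bound uniform in d that [tannery_zero] asks for: a derivative of order n is divided by
    the n-th power of a factor at least 1. *)
Lemma dilate_bound (R : realType) (phi : R -> R) (M : R) (n d : nat) :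
  test_function phi -> (forall x, `|derive1n n phi x| <= M) ->
  forall x, `|derive1n n (dilate d.+1%:R phi) x| <= M.
Proof.
move=> tphi hM x; rewrite derive1n_dilate// normrM.
have d1 : 1 <= d.+1%:R ^+ n :> R by rewrite exprn_ege1// ler1n.
rewrite (le_trans _ (hM (x / d.+1%:R)))// ler_piMl//.
by rewrite normfV gtr0_norm ?(lt_le_trans ltr01)// invf_le1// (lt_le_trans ltr01).
Qed.

Lemma seriesB (R : realType) (u v : nat -> R) (l m : R) :
  series u @ \oo --> l -> series v @ \oo --> m ->
  series (fun k => u k - v k) @ \oo --> l - m.
Proof.
move=> ul vm; have -> : series (fun k => u k - v k) = series u - series v.
  by apply/funext => n; rewrite /series /= sumrB.
exact: cvgB.
Qed.

(** Both decompositions give f the same value on [Theta (t / d) - Theta t]. Hence g(phi) - U' equals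
    g(phi_d) - L'(d) for every d, where phi_d is the dilate and U', L' are the sums of the second
    series. Both terms on the right tend to 0 by [tannery_zero]. *)
Lemma hardy_sum_transfer (R : realType) (p : R) (q : \bar R) (s : nat)
    (f g : distribution_on_Rplus R) (lam lam' : nat -> R) (a a' : nat -> R -> R) :
  0 < p -> p <= 1 -> (1 < q)%E -> p^-1 <= s.+2%:R ->
  atomic_decomposition (@Latom R p q s) p f lam a ->
  sum_in_distributions lam (fun k => hardy (a k)) g ->
  atomic_decomposition (@Latom R p q s) p f lam' a' ->
  sum_in_distributions lam' (fun k => hardy (a' k)) g.
Proof.
move=> p0 p1 q1 ps [La cl fl] hg [La' cl' fl'] phi tphi.
have [M hM] := bounded_derivatives s.+1 tphi.
have M0 x : `|phi x| <= M by exact: (hM 0%N).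
have Ms x : `|derive1n s.+1 phi x| <= M by exact: hM.
set C := (1 - fine q^-1)^-1 * M.
have tphid d : test_function (dilate d.+1%:R phi) by exact: test_function_dilate.
have bd b d : Latom p q s b -> `|integrate_against (hardy b) (dilate d.+1%:R phi)| <= C.
  move=> Lb; apply: hardy_pairing_bound p0 p1 q1 ps Lb (tphid d) _ _.
    exact: (@dilate_bound _ phi M 0 d tphi M0).
  exact: dilate_bound.
have b0 b : Latom p q s b -> `|integrate_against (hardy b) phi| <= C.
  by move=> Lb; exact: hardy_pairing_bound p0 p1 q1 ps Lb tphi _ _.
have sl := summable_of_powR p0 p1 cl; have sl' := summable_of_powR p0 p1 cl'.
pose t d k := integrate_against (hardy (a k)) (dilate d.+1%:R phi).
pose t' d k := integrate_against (hardy (a' k)) (dilate d.+1%:R phi).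
have tL d : series (fun k => lam k * t d k) @ \oo --> g (dilate d.+1%:R phi).
  exact: hg.
pose L' d := limn (series (fun k => lam' k * t' d k)).
have tL' d : series (fun k => lam' k * t' d k) @ \oo --> L' d.
  by apply: cvg_series_bounded sl' _ => k; exact: bd.
have L0 := tannery_zero sl (fun d k => bd _ d (La k))
  (fun k => hardy_pairing_far q1 (La k) tphi) tL.
have L'0 := tannery_zero sl' (fun d k => bd _ d (La' k))
  (fun k => hardy_pairing_far q1 (La' k) tphi) tL'.
pose U' := limn (series (fun k => lam' k * integrate_against (hardy (a' k)) phi)).
have tU' : series (fun k => lam' k * integrate_against (hardy (a' k)) phi) @ \oo --> U'.
  by apply: cvg_series_bounded sl' _ => k; exact: b0.
have [Th dTheta tTheta] := adjoint_primitive tphi.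
have gU d : g phi - U' = g (dilate d.+1%:R phi) - L' d.
  have d1 : 1 <= d.+1%:R :> R by rewrite ler1n.
  have d0 : 0 < d.+1%:R :> R by rewrite ltr0n.
  have tT := tTheta _ d1.
  have E1 : f (fun x => Th (x / d.+1%:R) - Th x) = g phi - g (dilate d.+1%:R phi).
    have h := fl _ tT; rewrite (_ : (fun k => _) = (fun k => lam k *
      integrate_against (hardy (a k)) phi - lam k * t d k)) in h.
      exact: (cvg_unique _ h (seriesB (hg _ tphi) (tL d))).
    apply/funext => k.
    by rewrite -mulrBr (hardy_pairing_dilate q1 (La k) tphi d0 dTheta).
  have E2 : f (fun x => Th (x / d.+1%:R) - Th x) = U' - L' d.
    have h := fl' _ tT; rewrite (_ : (fun k => _) = (fun k => lam' k *
      integrate_against (hardy (a' k)) phi - lam' k * t' d k)) in h.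
      exact: (cvg_unique _ h (seriesB (tU') (tL' d))).
    apply/funext => k.
    by rewrite -mulrBr (hardy_pairing_dilate q1 (La' k) tphi d0 dTheta).
  have := E1; rewrite E2 => h; lra.
suff -> : g phi = U' by [].
apply/eqP; rewrite -subr_eq0; apply/eqP.
have h1 : (fun d => g (dilate d.+1%:R phi) - L' d) @ \oo --> (0 - 0 : R).
  exact: cvgB L0 L'0.
rewrite subrr in h1; apply: (cvg_unique _ _ h1) => //.
rewrite (_ : (fun _ => _) = cst (g phi - U')); first exact: cvg_cst.
by apply/funext => d; rewrite /= (gU d).
Qed.

(** * The case 1/p > s + 2 *)

(* [e ^- n.+1 * step e n y] approximates [phi |-> derive1n n phi y]. *)
Fixpoint step (R : realType) (e : R) (n : nat) (y : R) : R -> R :=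
  if n is n'.+1 then fun x => step e n' (y + e) x - step e n' y x
  else \1_(`[y, y + e]%classic : set R).

Lemma carried_by_widen (R : realType) (b : R -> R) (u v u' v' : R) :
  0 < u' -> u' <= u -> v <= v' -> carried_by b u v -> carried_by b u' v'.
Proof.
move=> u'0 u'u vv' [u0 sb ib]; split => // x /sb /andP[ux xv].
by rewrite (le_trans u'u)// (le_trans xv).
Qed.

Lemma carried_by_sub (R : realType) (b c : R -> R) (u v : R) :
  carried_by b u v -> carried_by c u v -> carried_by (fun x => b x - c x) u v.
Proof.
move=> [u0 sb ib] [_ sc ic]; split => //; last exact: (integrableB _ ib ic).
move=> x; have [->|/sb//] := eqVneq (b x) 0.
by rewrite sub0r oppr_eq0; exact: sc.
Qed.

Lemma step_carried (R : realType) (e : R) (n : nat) (y : R) : 0 < e -> 0 < y ->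
  carried_by (step e n y) y (y + n.+1%:R * e).
Proof.
move=> e0; elim: n y => [|n ih] y y0.
  split => //.
    move=> x /=; rewrite mul1r indicE; have [|] := boolP (x \in _).
      by rewrite inE /= in_itv.
    by rewrite eqxx.
  by apply: integrable_indic_itv.
apply: carried_by_sub.
  have ye0 : 0 < y + e by rewrite addr_gt0.
  apply: carried_by_widen (ih _ ye0) => //; first by rewrite lerDl ltW.
  by rewrite -addrA lerD2l -[X in X + _]mul1r -mulrDl -[n.+2%:R]natr1 addrC.
apply: carried_by_widen (ih _ y0) => //.
by rewrite lerD2l ler_pM2r// ler_nat.
Qed.

Lemma step_bound (R : realType) (e : R) (n : nat) (y x : R) :
  `|step e n y x| <= 2 ^+ n.
Proof.
elim: n y => [|n ih] y /=.
  by rewrite indicE normr_nat expr0; case: (_ \in _).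
by rewrite (le_trans (ler_normB _ _))// exprS mulr2n mulrDl mul1r lerD.
Qed.

(** Against phi the indicator already produces one difference of the primitive [Phi]; hence the
    order n + 1. *)
Lemma step_pairing (R : realType) (e : R) (n : nat) (y : R) (phi Phi : R -> R) :
  0 < e -> 0 < y -> continuous phi ->
  (forall x : R, is_derive x 1 Phi (phi x)) ->
  \int[lebesgue_measure]_x (step e n y x * phi x) = findiff e n.+1 Phi y.
Proof.
move=> e0 + cphi dPhi; elim: n y => [|n ih] y y0.
  rewrite /= /Rintegral.
  have /(_ (ltW _)) h := @integral_derivative _ Phi phi y (y + e).
  rewrite -[RHS]/(fine (Phi (y + e) - Phi y)%:E) -h ?ltrDl//; last first.
    exact: continuous_subspaceT.
  congr fine; rewrite [RHS]integral_mkcond; apply: eq_integral => x _.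
  rewrite patchE indicE; case: ifPn => _; by rewrite ?mul1r ?mul0r.
have ye0 : 0 < y + e by rewrite addr_gt0.
have ci u v : {within `[u, v], continuous phi} by exact: continuous_subspaceT.
rewrite -[RHS]/(findiff e n.+1 Phi (y + e) - findiff e n.+1 Phi y) -!ih//.
rewrite -RintegralB//.
- by apply: eq_Rintegral => x _; rewrite mulrBl.
- exact: integrable_carriedM (step_carried n e0 ye0) (ci _ _).
- exact: integrable_carriedM (step_carried n e0 y0) (ci _ _).
Qed.

(** One factor 1/e normalises the indicator of [y, y + e], the other s + 1 turn its differences into
    difference quotients. The result is bounded and annihilates polynomials of degree s, as an atom
    must. *)
Definition bump (R : realType) (e : R) (s : nat) (y x : R) : R :=
  e ^- s.+2 * step e s.+1 y x.

Lemma bump_carried (R : realType) (e : R) (s : nat) (y : R) : 0 < e -> 0 < y ->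
  carried_by (bump e s y) y (y + s.+2%:R * e).
Proof. by move=> e0 y0; exact: carried_scale (step_carried _ _ _). Qed.

(** The list F starts at a primitive of the integrand, so [F s.+2] is the derivative of order s + 1
    of [F 1]. In this form the lemma serves both test functions and monomials. *)
Lemma bump_mean_value (R : realType) (e : R) (s : nat) (y : R)
    (F : nat -> R -> R) : 0 < e -> 0 < y -> continuous (F 1%N) ->
  (forall (i : nat) (x : R), (i < s.+2)%N -> is_derive x 1 (F i) (F i.+1 x)) ->
  exists2 xi, y <= xi <= y + s.+2%:R * e &
    \int[lebesgue_measure]_x (bump e s y x * F 1%N x) = F s.+2 xi.
Proof.
move=> e0 y0 cF dF.
have [|xi hxi E] := @findiff_mean_value R e s.+2 F y e0.
  by move=> i x iss _; exact: dF.
exists xi => //; rewrite /bump; under eq_Rintegral do rewrite -mulrA.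
rewrite RintegralZl//; last first.
  apply: integrable_carriedM (step_carried s.+1 e0 y0) _.
  exact: continuous_subspaceT.
have -> : \int[lebesgue_measure]_x (step e s.+1 y x * F 1%N x) =
    findiff e s.+2 (F 0%N) y.
  by apply: step_pairing => // x; exact: dF.
by rewrite E mulrA mulVf ?mul1r// expf_neq0// gt_eqF.
Qed.

Lemma bump_pairing (R : realType) (e : R) (s : nat) (y : R) (phi : R -> R) :
  0 < e -> 0 < y -> test_function phi ->
  exists2 xi, y <= xi <= y + s.+2%:R * e &
    integrate_against (bump e s y) phi = derive1n s.+1 phi xi.
Proof.
move=> e0 y0 tphi; rewrite (integrate_against_carried _ (bump_carried s e0 y0)).
have [_ [a [b [a0 sphi]]]] := tphi.
have cphi := @continuous_test _ _ 0 tphi.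
have [|Phi dPhi _] := @primitive_exists R phi (a / 2) cphi.
  move=> x xa; apply/eqP; apply: contraT => /sphi; rewrite leNgt.
  by rewrite (le_lt_trans xa)// gtr_pMr// invf_lt1 ?ltr1n.
pose F i := if i is j.+1 then derive1n j phi else Phi.
apply: (@bump_mean_value R e s y F) => //.
by case=> [|i] x _; [exact: dPhi|exact: is_derive_test].
Qed.

Lemma bump_moment (R : realType) (e : R) (s : nat) (y : R) (beta : nat) :
  0 < e -> 0 < y -> (beta <= s)%N ->
  \int[lebesgue_measure]_x (bump e s y x * x ^+ beta) = 0.
Proof.
move=> e0 y0 bs.
(* The falling factorial of beta of order j is the coefficient of the j-th derivative of x^beta; it
   is 0 at j = s + 1 > beta. *)
pose F i (x : R) := if i is j.+1 then (beta ^_ j)%:R * x ^+ (beta - j)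
  else beta.+1%:R^-1 * x ^+ beta.+1.
have F1 : F 1%N = fun x => x ^+ beta.
  by apply/funext => x; rewrite /F /= ffactn0 mul1r subn0.
have [||xi _] := @bump_mean_value R e s y F e0 y0.
- rewrite F1; apply: (@is_derive_continuous _ _ (fun x => beta%:R * x ^+ beta.-1)) => x.
  exact: is_derive_exprn.
- case=> [|i] x _.
    rewrite F1; apply: (is_derive_eq (is_derive_scale _ (is_derive_exprn _ _))).
    by rewrite mulrA mulVf ?mul1r// pnatr_eq0.
  apply: (is_derive_eq (is_derive_scale _ (is_derive_exprn _ _))).
  by rewrite /F /= mulrA -natrM ffactnSr subnS.
by rewrite F1 => ->; rewrite /F ffact_small ?mul0r// ltnS.
Qed.

(** The bound 2^(s+1) e^-(s+2) on the bump, times the power 1/p of the length of its interval: the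
    support [y, y + (s + 2) e] is widened by e on either side. *)
Definition bump_size (R : realType) (p e : R) (s : nat) : R :=
  2 ^+ s.+1 * e ^- s.+2 * (s.+4%:R * e) `^ p^-1.

Lemma bump_size_gt0 (R : realType) (p e : R) (s : nat) : 0 < e ->
  0 < bump_size p e s.
Proof.
move=> e0; rewrite /bump_size mulr_gt0//; last by rewrite powR_gt0// mulr_gt0.
by rewrite mulr_gt0// ?invr_gt0 exprn_gt0.
Qed.

Lemma bump_atom (R : realType) (p e : R) (q : \bar R) (s : nat) (y : R) :
  0 < p -> (1 < q)%E -> 0 < e < y ->
  atom p q s (fun x => (bump_size p e s)^-1 * bump e s y x).
Proof.
move=> p0 q1 /andP[e0 ey]; have y0 : 0 < y by rewrite (lt_trans e0).
have cb := bump_carried s e0 y0; have cb' := carried_scale (bump_size p e s)^-1 cb.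
have mu0 := bump_size_gt0 p s e0.
have [_ sb' ib'] := cb'.
have IE : y + s.+3%:R * e - (y - e) = s.+4%:R * e.
  by rewrite -[s.+4%:R]natr1; ring.
have I0 : 0 < s.+4%:R * e by rewrite mulr_gt0.
have I01 : y - e < y + s.+3%:R * e by rewrite -subr_gt0 IE.
apply: (@carried_atom R p q s _ (y - e) (y + s.+3%:R * e) _ _ _ _ cb').
- by rewrite subr_gt0 ey ltrBlDr ltrDl.
- by rewrite lerDl mulr_ge0 ?(ltW e0)//= ltrD2l ltr_pM2r// ltr_nat.
- rewrite IE; apply: le_trans (Lq_le_sup (S := (s.+4%:R * e) `^ (- p^-1)) q1 I01 (powR_ge0 _ _) _ _ _) _.
  + apply/measurable_EFinP; exact: measurable_int ib'.
  + move=> x /sb' /andP[yx xy]; rewrite (le_trans _ yx)/=; last first.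
      by rewrite lerBlDr lerDl ltW.
    by rewrite (le_trans xy)// lerD2l ler_pM2r// ler_nat.
  + move=> x; rewrite normrM gtr0_norm ?invr_gt0// ler_pdivrMl//.
    rewrite /bump normrM gtr0_norm ?invr_gt0 ?exprn_gt0// /bump_size.
    rewrite -[leRHS]mulrA -powRD; last by rewrite (gt_eqF I0) implybT.
    rewrite subrr powRr0 mulr1 mulrC ler_wpM2r ?step_bound//.
    by rewrite invr_ge0 exprn_ge0 ?ltW.
  rewrite IE lee_fin -powRD; last by rewrite (gt_eqF I0) implybT.
  by rewrite addrC.
move=> beta hb; under eq_Rintegral do rewrite -mulrA.
rewrite RintegralZl ?bump_moment ?mulr0//.
apply: integrable_carriedM cb _.
apply: (@is_derive_within_continuous _ _ (fun x => beta%:R * x ^+ beta.-1)) => x _.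
exact: is_derive_exprn.
Qed.

Lemma bump_size_small (R : realType) (p t : R) (s : nat) :
  0 < p -> s.+2%:R < p^-1 -> 0 < t ->
  exists2 e0 : R, 0 < e0 & forall e, 0 < e <= e0 -> bump_size p e s `^ p <= t.
Proof.
move=> p0 ps t0; pose alpha := p^-1 - s.+2%:R.
have alpha0 : 0 < alpha by rewrite subr_gt0.
pose K : R := 2 ^+ s.+1 * s.+4%:R `^ p^-1.
have K0 : 0 < K by rewrite mulr_gt0 ?exprn_gt0 ?powR_gt0.
have tK : 0 < t `^ p^-1 / K by rewrite divr_gt0// powR_gt0.
(* The solution of K e^alpha = t^(1/p); that alpha is positive is the hypothesis of this case. *)
exists ((t `^ p^-1 / K) `^ alpha^-1); first exact: powR_gt0.
move=> e /andP[e0 ee].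
have -> : bump_size p e s = K * e `^ alpha.
  rewrite /bump_size /K /alpha powRM ?(ltW e0)// powRB; last by rewrite (gt_eqF e0) implybT.
  by rewrite powR_mulrn ?(ltW e0)//; ring.
rewrite -[leRHS]powRr1 ?(ltW t0)// -(mulVf (lt0r_neq0 p0)) powRrM.
rewrite ge0_ler_powR ?nnegrE ?mulr_ge0 ?powR_ge0 ?(ltW K0) ?(ltW p0)//.
rewrite -ler_pdivlMl// mulrC.
have -> : t `^ p^-1 / K = ((t `^ p^-1 / K) `^ alpha^-1) `^ alpha.
  by rewrite -powRrM mulVf ?gt_eqF// powRr1// ltW.
by rewrite ge0_ler_powR ?nnegrE ?powR_ge0 ?(ltW e0) ?(ltW alpha0).
Qed.

(** * Quadrature: atoms as limits of combinations of Dirac derivatives *)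

Lemma iter_primitive (R : realType) (n : nat) (f : R -> R) (a : R) :
  continuous f -> (forall x, x <= a -> f x = 0) ->
  exists G : nat -> R -> R, [/\ G n = f, continuous (G 0%N) &
    forall (i : nat) (x : R), (i < n)%N -> is_derive x 1 (G i) (G i.+1 x)].
Proof.
elim: n f => [|n ih] f cf f0; first by exists (fun=> f).
have [F dF F0] := primitive_exists cf f0.
have [|G [Gn cG dG]] := ih F _ F0; first exact: is_derive_continuous dF.
exists (fun i => if i == n.+1 then f else G i); split; rewrite ?eqxx//.
move=> i x; rewrite ltnS leq_eqVlt => /predU1P[->|ilt].
  by rewrite eqxx (ltn_eqF (ltnSn n)) Gn.
by rewrite (ltn_eqF (leqW ilt)) eqSS (ltn_eqF ilt); exact: dG.
Qed.

(* This is [min (max (x - z) 0) h]. *)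
Definition clamp (R : realType) (h z x : R) : R :=
  (`|x - z| - `|x - z - h| + h) / 2.

Lemma clamp_continuous (R : realType) (h z : R) : continuous (clamp h z).
Proof.
move=> x; apply: cvgM; last exact: cvg_cst.
apply: cvgD; last exact: cvg_cst.
apply: cvgB; apply: cvg_norm; apply: cvgB; try exact: cvg_cst.
  exact: cvg_id.
by apply: cvgB; [exact: cvg_id|exact: cvg_cst].
Qed.

Lemma clamp_left (R : realType) (h z x : R) : 0 <= h -> x <= z -> clamp h z x = 0.
Proof.
by move=> h0 xz; rewrite /clamp !ler0_norm; lra.
Qed.

Lemma clamp_mid (R : realType) (h z x : R) : z <= x <= z + h -> clamp h z x = x - z.
Proof.
by move=> /andP[zx xz]; rewrite /clamp ger0_norm ?subr_ge0// ler0_norm; lra.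
Qed.

Lemma clamp_right (R : realType) (h z x : R) : 0 <= h -> z + h <= x -> clamp h z x = h.
Proof.
by move=> h0 zx; rewrite /clamp !ger0_norm; lra.
Qed.

(** The bound is linear in t - z, with the cell width h as a separate factor, so that the errors of
    consecutive cells add up to M h times the total length. *)
Lemma taylor1 (R : realType) (f0 f1 f2 : R -> R) (z t h M : R) :
  (forall x : R, is_derive x 1 f0 (f1 x)) ->
  (forall x : R, is_derive x 1 f1 (f2 x)) ->
  (forall x, `|f2 x| <= M) -> z <= t <= z + h ->
  `|f0 t - f0 z - f1 z * (t - z)| <= M * h * (t - z).
Proof.
move=> d0 d1 M2 /andP[zt th].
have M0 : 0 <= M by exact: le_trans (normr_ge0 _) (M2 0).
have -> : f0 t - f0 z - f1 z * (t - z) = (f0 t - f1 z * t) - (f0 z - f1 z * z).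
  by ring.
apply: (@le_derive_increment _ (fun x => f0 x - f1 z * x) (fun x => f1 x - f1 z)) => //.
  move=> x _; apply: is_derive_sub => //.
  have h1 := is_derive_scale (f1 z) (is_derive_id x (1 : R)).
  by apply: (is_derive_eq h1); rewrite mulr1.
move=> x /andP[zx xt]; apply: (@le_trans _ _ (M * (x - z))).
  by apply: (@le_derive_increment _ f1 f2) => //.
by rewrite ler_wpM2l// lerBlDl (le_trans xt).
Qed.

(** The sum is the integral, from u to the minimum of x and u + n h, of the step function equal on
    each cell to f1 at its left end. Stopping at the n-th cell allows an induction on n with x
    fixed. *)
Lemma clamp_approx (R : realType) (f0 f1 f2 : R -> R) (u h M : R) (n : nat) (x : R) :
  (forall x : R, is_derive x 1 f0 (f1 x)) ->
  (forall x : R, is_derive x 1 f1 (f2 x)) ->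
  (forall x, `|f2 x| <= M) -> 0 <= h -> u <= x ->
  `|f0 (Num.min x (u + n%:R * h)) - f0 u -
    \sum_(j < n) f1 (u + j%:R * h) * clamp h (u + j%:R * h) x| <=
  M * h * (Num.min x (u + n%:R * h) - u).
Proof.
move=> d0 d1 M2 h0 ux; elim: n => [|n ih].
  by rewrite mul0r addr0 (min_idPr ux) big_ord0 !subrr normr0 mulr0.
rewrite big_ord_recr/=; set z := u + n%:R * h in ih *.
have -> : u + n.+1%:R * h = z + h by rewrite /z -natr1; ring.
have [xz|zx] := leP x z.
  rewrite (min_idPl xz) in ih.
  by rewrite clamp_left// mulr0 addr0 (min_idPl _)// ler_wpDr.
rewrite (min_idPr (ltW zx)) in ih.
set t := Num.min x (z + h).
have zt : z <= t <= z + h.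
  by rewrite /t le_min (ltW zx) lerDl h0 /= ge_min lexx orbT.
have -> : clamp h z x = t - z.
  rewrite /t; have [xzh|zhx] := leP x (z + h).
    by rewrite clamp_mid// (ltW zx).
  by rewrite clamp_right// ?(ltW zhx)//; ring.
have -> : M * h * (t - u) = M * h * (z - u) + M * h * (t - z) by ring.
have T := taylor1 d0 d1 M2 zt.
set S := \sum_(_ < n) _ in ih *.
have -> : f0 t - f0 u - (S + f1 z * (t - z)) =
  (f0 z - f0 u - S) + (f0 t - f0 z - f1 z * (t - z)) by ring.
by rewrite (le_trans (ler_normD _ _))// lerD.
Qed.

(** Integrating [clamp_approx] s times brings phi close on [u, v] to a polynomial of degree s plus
    the sum of phi^(s+1)(y_j) G_j, with G_j an s-fold primitive of a clamp. The moments of b remove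
    the polynomial. The weights are the integrals of b G_j, free of phi, so one list L serves all
    test functions. *)
Lemma quadrature (R : realType) (b : R -> R) (u v eta : R) (s : nat) :
  carried_by b u v -> u <= v ->
  (forall beta, (beta <= s)%N ->
    \int[lebesgue_measure]_x (b x * x ^+ beta) = 0) -> 0 < eta ->
  exists L : seq (R * R), (forall z, z \in L -> 0 < z.2) /\
    forall phi M, test_function phi -> (forall x, `|derive1n s.+2 phi x| <= M) ->
      `|\int[lebesgue_measure]_x (b x * phi x) -
        \sum_(z <- L) z.1 * derive1n s.+1 phi z.2| <= eta * M.
Proof.
move=> cb uv mom eta0; have [u0 sb ib] := cb.
set A := \int[lebesgue_measure]_x `|b x|.
have A0 : 0 <= A by exact: Rintegral_ge0.
(* Enough cells for h (v - u)^(s+1) A, the error per unit of M, to be at most eta. *)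
pose N := (Num.truncn ((v - u) ^+ s.+2 * A / eta)).+1.
have N0 : 0 < N%:R :> R by rewrite ltr0n.
pose h := (v - u) / N%:R.
have h0 : 0 <= h by rewrite divr_ge0// subr_ge0.
have hA : h * (v - u) ^+ s.+1 * A <= eta.
  have -> : h * (v - u) ^+ s.+1 * A = (v - u) ^+ s.+2 * A / N%:R.
    by rewrite /h [(v - u) ^+ s.+2]exprS; ring.
  rewrite ler_pdivrMr//; have := truncnS_gt ((v - u) ^+ s.+2 * A / eta).
  by rewrite ltr_pdivrMr// [X in _ < X]mulrC => /ltW.
have uN : u + N%:R * h = v by rewrite /h mulrC divfK ?gt_eqF// addrC subrK.
pose y j := u + j%:R * h.
have [G hG] : exists G : nat -> nat -> R -> R, forall j, [/\ G j s = clamp h (y j),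
    continuous (G j 0%N) &
    forall (i : nat) (x : R), (i < s)%N -> is_derive x 1 (G j i) (G j i.+1 x)].
  have /choice[G hG] j := iter_primitive s (@clamp_continuous R h (y j))
    (fun x => @clamp_left R h (y j) x h0).
  by exists G.
exists [seq (\int[lebesgue_measure]_x (b x * G j 0%N x), y j) | j <- iota 0 N].
split.
  move=> _ /mapP[j _ ->] /=; rewrite /y ltr_wpDr//.
  by rewrite mulr_ge0.
move=> phi M tphi hM.
have M0 : 0 <= M by exact: le_trans (normr_ge0 _) (hM 0).
pose w j := derive1n s.+1 phi (y j).
pose F i x := derive1n i phi x - \sum_(j < N) w j * G j i x.
rewrite big_map -[X in iota 0 X](subn0 N) -/(index_iota 0 N) big_mkord /=.
have [||c hc] := @poly_approx R u v (M * h * (v - u)) (derive1n s phi u) s F uv.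
- move=> i x si _; apply: is_derive_sub; first exact: is_derive_test.
  apply: (@is_derive_bigsum R N (fun j x => w j * G j i x)
    (fun j => w j * G j i.+1 x)) => j.
  by apply: is_derive_scale; have [_ _] := hG j; exact.
- move=> x /andP[ux xv]; rewrite /F.
  have := @clamp_approx R _ _ _ u h M N x (fun x => is_derive_test s x tphi)
    (fun x => is_derive_test s.+1 x tphi) hM h0 ux.
  rewrite uN (min_idPl xv) => hh.
  have -> : \sum_(j < N) w j * G j s x =
      \sum_(j < N) derive1n s.+1 phi (u + j%:R * h) * clamp h (u + j%:R * h) x.
    by apply: eq_bigr => j _; have [-> _ _] := hG j.
  rewrite addrAC; apply: le_trans hh _.
  by apply: ler_wpM2l; [exact: mulr_ge0|rewrite lerD2r].
have cG j : continuous (G j 0%N) by have [] := hG j.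
have cphi := @continuous_test _ _ 0 tphi.
have cK : continuous (fun x => \sum_(j < N) w j * G j 0%N x).
  exact: (@continuous_big_sum _ (fun j => G j 0%N)).
pose P x := \sum_(i < s.+1) c i * x ^+ i.
have cP : continuous P.
  apply: (@continuous_big_sum _ (fun i x => x ^+ i)) => j; exact: exprn_continuous.
have E1 : \int[lebesgue_measure]_x (b x * (F 0%N x - P x)) =
  \int[lebesgue_measure]_x (b x * phi x) -
  \sum_(j < N) (\int[lebesgue_measure]_x (b x * G j 0%N x)) * derive1n s.+1 phi (y j).
  have i1 := integrable_carriedM cb (continuous_subspaceT cphi).
  have i2 := integrable_carriedM cb (continuous_subspaceT cK).
  have i3 := integrable_carriedM cb (continuous_subspaceT cP).
  transitivity (\int[lebesgue_measure]_x
      ((b x * phi x - b x * \sum_(j < N) w j * G j 0%N x) - b x * P x)).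
    by apply: eq_Rintegral => x _; rewrite /F !mulrBr.
  rewrite RintegralB//; last exact: (integrableB _ i1 i2).
  rewrite RintegralB// [X in _ - X](moment_poly _ cb) ?subr0//.
  rewrite (pairing_sum (K := fun j => G j 0%N) _ _ cb)//.
  by congr (_ - _); apply: eq_bigr => j _; rewrite mulrC.
rewrite -E1.
have cFP : {within `[u, v], continuous (fun x => F 0%N x - P x)}.
  apply: continuous_subspaceT => x; apply: cvgB; last exact: cP.
  by apply: cvgB; [exact: cphi|exact: cK].
apply: le_trans (pairing_bound cb cFP hc) _; rewrite -/A.
rewrite (_ : _ * A = h * (v - u) ^+ s.+1 * A * M); last by rewrite exprS; ring.
by rewrite ler_wpM2r.
Qed.

(** * Infinite concatenations of finite blocks *)

Lemma flatten_blocks (T : Type) (d : T) (blk : nat -> seq T) :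
  (forall n, (0 < size (blk n))%N) ->
  exists (t : nat -> T) (idx r : nat -> nat),
    (forall N, mkseq t N =
      flatten (mkseq blk (idx N)) ++ take (r N) (blk (idx N))) /\
    (forall n, exists N0, forall N, (N0 <= N)%N -> (n <= idx N)%N).
Proof.
move=> blk0; pose W n := flatten (mkseq blk n).
have WS n : W n.+1 = W n ++ blk n by rewrite /W mkseqS flatten_rcons.
have sizeW n : (n <= size (W n))%N.
  elim: n => [//|n ih]; rewrite WS size_cat -addn1.
  by rewrite leq_add// blk0.
have nthW n m i : (n <= m)%N -> (i < size (W n))%N -> nth d (W m) i = nth d (W n) i.
  move=> nm isn; elim: m nm => [|m ih]; first by rewrite leqn0 => /eqP ->.
  rewrite leq_eqVlt => /predU1P[->//|]; rewrite ltnS => nm.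
  rewrite WS nth_cat -ih//; case: ltnP => // h.
  have nm' : (size (W n) <= size (W m))%N.
    elim: m nm {ih h} => [|m ih]; first by rewrite leqn0 => /eqP ->.
    rewrite leq_eqVlt => /predU1P[->//|]; rewrite ltnS => /ih /leq_trans; apply.
    by rewrite WS size_cat leq_addr.
  by move: h; rewrite leqNgt (leq_trans isn nm').
pose t i := nth d (W i.+1) i.
have exP N : exists n, (size (W n) <= N)%N by exists 0%N.
have ubP N n : (size (W n) <= N)%N -> (n <= N)%N by exact: leq_trans (sizeW n).
(* The number of blocks completed within the first N terms; it is bounded because n nonempty blocks
   have at least n terms. *)
pose idx N := ex_maxn (exP N) (ubP N).
exists t, idx, (fun N => N - size (W (idx N)))%N; split => [N|n].
  rewrite /idx; case: ex_maxnP => n hn maxn.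
  have Nlt : (N < size (W n.+1))%N.
    by rewrite ltnNge; apply/negP => /maxn; rewrite ltnn.
  have -> : mkseq t N = take N (W n.+1).
    apply: (@eq_from_nth _ d) => [|i]; first by rewrite size_mkseq size_takel// ltnW.
    rewrite size_mkseq => iN; rewrite nth_mkseq// nth_take// /t.
    have [h|/ltnW h] := leqP i.+1 n.+1.
      by rewrite (nthW i.+1 n.+1).
    by rewrite (nthW n.+1 i.+1)// (ltn_trans iN).
  by rewrite WS take_cat ltnNge hn.
exists (size (W n)) => N hN; rewrite /idx; case: ex_maxnP => m _; exact.
Qed.

Lemma take_flatten_nseq (T : Type) (D : seq T) (m r : nat) :
  exists j r', (j <= m)%N /\
    take r (flatten (nseq m D)) = flatten (nseq j D) ++ take r' D.
Proof.
elim: m r => [|m ih] r; first by exists 0%N, 0%N; rewrite take0.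
rewrite /= take_cat; case: ltnP => [rD|Dr].
  by exists 0%N, r.
have [j [r' [jm ->]]] := ih (r - size D)%N.
by exists j.+1, r'; rewrite ltnS jm /= catA.
Qed.

Lemma mem_flatten_nseq (T : eqType) (D : seq T) (m : nat) :
  {subset flatten (nseq m D) <= D}.
Proof.
by elim: m => [//|m ih] z; rewrite /= mem_cat => /orP[|/ih].
Qed.

Lemma sum_flatten_nseq (R : realType) (T : Type) (D : seq T) (F : T -> R) (m : nat) :
  \sum_(z <- flatten (nseq m D)) F z = m%:R * \sum_(z <- D) F z.
Proof.
elim: m => [|m ih]; first by rewrite big_nil mul0r.
by rewrite /= big_cat ih /= -natr1 mulrDl mul1r addrC.
Qed.

Lemma sum_take_le (R : realType) (T : Type) (D : seq T) (F : T -> R) (r : nat) :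
  (forall z, 0 <= F z) -> \sum_(z <- take r D) F z <= \sum_(z <- D) F z.
Proof.
move=> F0; rewrite -[in leRHS](cat_take_drop r D) big_cat /= lerDl.
by apply: sumr_ge0.
Qed.

(** Up to the sign (-1)^(s+1), the pairing with a combination of derivatives of order s + 1 of Dirac
    masses; an entry of L is a coefficient and a point. *)
Definition discrete_pairing (R : realType) (s : nat) (L : seq (R * R))
    (phi : R -> R) : R :=
  \sum_(z <- L) z.1 * derive1n s.+1 phi z.2.

Definition bump_sum (R : realType) (s : nat) (e : R) (L : seq (R * R))
    (phi : R -> R) : R :=
  \sum_(z <- L) z.1 * integrate_against (bump e s z.2) phi.

Lemma partial_sum_quadrature (R : realType) (p : R) (q : \bar R) (s : nat)
    (lam : nat -> R) (b : nat -> R -> R) (n : nat) (eta : R) :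
  (1 < q)%E -> (forall k, atom p q s (b k)) -> 0 < eta ->
  exists L : seq (R * R), (forall z, z \in L -> 0 < z.2) /\
    forall phi M, test_function phi -> (forall x, `|derive1n s.+2 phi x| <= M) ->
      `|series (fun k => lam k * integrate_against (b k) phi) n -
        discrete_pairing s L phi| <= eta * M.
Proof.
move=> q1 ab; elim: n eta => [|n ih] eta eta0.
  exists [::]; split => // phi M _ hM.
  rewrite /series /= big_geq// /discrete_pairing big_nil subrr normr0.
  by rewrite mulr_ge0 ?(ltW eta0)// (le_trans _ (hM 0)).
have [x0 [x1 [u [v [x0u /andP[uv vx1] cb bN mom]]]]] := atom_carried q1 (ab n).
have l0 : 0 < `|lam n| + 1 by rewrite ltr_wpDl.
have eta2 : 0 < eta / 2 by rewrite divr_gt0.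
have eta2' : 0 < eta / 2 / (`|lam n| + 1) by rewrite divr_gt0.
have [L1 [L1p hL1]] := ih _ eta2.
have [L2 [L2p hL2]] := quadrature cb uv mom eta2'.
exists (L1 ++ [seq (lam n * z.1, z.2) | z <- L2]); split.
  move=> z; rewrite mem_cat => /orP[/L1p//|/mapP[z' /L2p h ->//]].
move=> phi M tphi hM; have M0 : 0 <= M by exact: le_trans (normr_ge0 _) (hM 0).
have h1 := hL1 phi M tphi hM; have h2 := hL2 phi M tphi hM.
rewrite /discrete_pairing big_cat /= big_map /= -/(discrete_pairing s L1 phi).
rewrite seriesEnat /= big_nat_recr//=; rewrite seriesEnat /= in h1.
set S := \sum_(0 <= _ < n) _ in h1 *.
rewrite {1}/integrate_against restrict_Rplus_mul.
under [X in _ - (_ + X)]eq_bigr do rewrite -mulrA.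
rewrite -mulr_sumr; set I := \int[_]_x _ in h2 *; set J := \sum_(_ <- L2) _ in h2 *.
rewrite (_ : _ - _ = (S - discrete_pairing s L1 phi) + lam n * (I - J)); last by ring.
rewrite (le_trans (ler_normD _ _))// (_ : eta * M = eta / 2 * M + eta / 2 * M); last first.
  by rewrite -mulrDl -splitr.
rewrite lerD// normrM.
apply: (@le_trans _ _ ((`|lam n| + 1) * (eta / 2 / (`|lam n| + 1) * M))).
  by rewrite ler_pM// lerDl.
by rewrite mulrA mulrCA divff ?mulr1// gt_eqF.
Qed.

Lemma bump_sum_error (R : realType) (s : nat) (e : R) (L : seq (R * R))
    (phi : R -> R) (M : R) :
  0 < e -> (forall z, z \in L -> 0 < z.2) -> test_function phi ->
  (forall x, `|derive1n s.+2 phi x| <= M) ->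
  `|bump_sum s e L phi - discrete_pairing s L phi| <=
    (\sum_(z <- L) `|z.1|) * (s.+2%:R * e) * M.
Proof.
move=> e0 Lp tphi hM; rewrite /bump_sum /discrete_pairing -sumrB.
rewrite (le_trans (ler_norm_sum _ _ _))// -mulrA mulr_suml.
rewrite big_seq [leRHS]big_seq; apply: ler_sum => z zL.
rewrite -mulrBr normrM ler_wpM2l//.
have M0 : 0 <= M by exact: le_trans (normr_ge0 _) (hM 0).
have [xi /andP[yxi xiy] ->] := bump_pairing s e0 (Lp z zL) tphi.
apply: (@le_trans _ _ (M * (xi - z.2))); last first.
  by rewrite mulrC ler_wpM2r// lerBlDl.
apply: (@le_derive_increment R (derive1n s.+1 phi) (derive1n s.+2 phi) z.2 xi M yxi).
  by move=> x _; exact: is_derive_test.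
by move=> x _; exact: hM.
Qed.

Lemma bump_pairing_le (R : realType) (s : nat) (e y : R) (phi : R -> R) (M : R) :
  0 < e -> 0 < y -> test_function phi -> (forall x, `|derive1n s.+1 phi x| <= M) ->
  `|integrate_against (bump e s y) phi| <= M.
Proof.
by move=> e0 y0 tphi hM; have [xi _ ->] := bump_pairing s e0 y0 tphi.
Qed.

(** Gathers what is asked of the scale of one list: room to the left of each point for the interval
    of an atom, an error at most r when bumps replace Dirac derivatives, and a cost at most t. *)
Lemma exists_scale (R : realType) (p : R) (s : nat) (L : seq (R * R)) (t r c : R) :
  0 < p -> s.+2%:R < p^-1 -> 0 < t -> 0 < r -> 0 <= c ->
  (forall z, z \in L -> 0 < z.2) ->
  exists e : R, [/\ 0 < e, forall z, z \in L -> e < z.2,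
    (\sum_(z <- L) `|z.1|) * (s.+2%:R * e) <= r &
    c * bump_size p e s `^ p <= t].
Proof.
move=> p0 ps t0 r0 c0 Lp.
have [e1 e10 he1] : exists2 e1 : R, 0 < e1 & forall z, z \in L -> e1 < z.2.
  elim: L Lp => [|z L ih] Lp; first by exists 1.
  have [|e1 e10 he1] := ih; first by move=> z' z'L; apply: Lp; rewrite inE z'L orbT.
  have z0 : 0 < z.2 by apply: Lp; rewrite inE eqxx.
  exists (Num.min e1 (z.2 / 2)); first by rewrite lt_min e10 divr_gt0.
  move=> z'; rewrite inE => /predU1P[->|/he1 h].
    by rewrite gt_min gtr_pMr// invf_lt1 ?ltr1n ?orbT.
  by rewrite gt_min h.
have c1 : 0 < c + 1 by rewrite ltr_wpDl.
have tc : 0 < t / (c + 1) by rewrite divr_gt0.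
have [e2 e20 he2] := bump_size_small p0 ps tc.
set W := \sum_(z <- L) `|z.1|.
have W0 : 0 <= W by apply: sumr_ge0.
have W1 : 0 < W * s.+2%:R + 1 by rewrite ltr_wpDl// mulr_ge0.
pose e3 := r / (W * s.+2%:R + 1).
have e30 : 0 < e3 by rewrite divr_gt0.
exists (Num.min e1 (Num.min e2 e3)); split.
- by rewrite !lt_min e10 e20.
- by move=> z zL; rewrite gt_min he1.
- apply: (@le_trans _ _ ((W * s.+2%:R + 1) * e3)).
    rewrite mulrA ler_pM ?mulr_ge0//; first by rewrite !le_min !ltW.
      by rewrite lerDl.
    by rewrite !ge_min lexx !orbT.
  by rewrite /e3 mulrC divfK// gt_eqF.
apply: (@le_trans _ _ ((c + 1) * (t / (c + 1)))).
  rewrite ler_pM ?powR_ge0//; first by rewrite lerDl.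
  by apply: he2; rewrite !lt_min e10 e20 e30 /= !ge_min lexx orbT.
by rewrite mulrC divfK// gt_eqF.
Qed.

(** Entries are (coefficient, point, scale), so that a concatenation of lists at different scales
    still determines each atom. *)
Definition scaled_bumps (R : realType) (c e : R) (L : seq (R * R)) : seq (R * R * R) :=
  [seq (c * z.1, z.2, e) | z <- L].

Lemma scaled_bumps_sum (R : realType) (s : nat) (c e : R) (L : seq (R * R))
    (phi : R -> R) :
  \sum_(z <- scaled_bumps c e L) z.1.1 * integrate_against (bump z.2 s z.1.2) phi =
  c * bump_sum s e L phi.
Proof.
rewrite big_map /bump_sum mulr_sumr; apply: eq_bigr => z _ /=.
by rewrite mulrA.
Qed.

Lemma scaled_bumps_norm (R : realType) (s : nat) (c e M : R) (L : seq (R * R))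
    (phi : R -> R) :
  0 < e -> 0 <= c -> (forall z, z \in L -> 0 < z.2) -> test_function phi ->
  (forall x, `|derive1n s.+1 phi x| <= M) ->
  \sum_(z <- scaled_bumps c e L)
    `|z.1.1 * integrate_against (bump z.2 s z.1.2) phi| <=
  c * (\sum_(z <- L) `|z.1|) * M.
Proof.
move=> e0 c0 Lp tphi hM; rewrite big_map mulr_sumr mulr_suml.
rewrite big_seq [leRHS]big_seq; apply: ler_sum => z zL /=.
rewrite !normrM (ger0_norm c0) ler_wpM2l ?mulr_ge0//.
exact: bump_pairing_le (Lp z zL) tphi hM.
Qed.

(** Whatever is gained from |c| <= 1 is discarded. The bound for one copy is later multiplied by the
    number of copies, which is paid for by a scale chosen afterwards. *)
Lemma scaled_bumps_cost (R : realType) (p : R) (s : nat) (c e : R)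
    (L : seq (R * R)) : 0 < p -> `|c| <= 1 -> 0 < e ->
  \sum_(z <- scaled_bumps c e L) `|z.1.1 * bump_size p z.2 s| `^ p <=
  (\sum_(z <- L) `|z.1| `^ p) * bump_size p e s `^ p.
Proof.
move=> p0 c1 e0; rewrite big_map mulr_suml; apply: ler_sum => z _ /=.
have mu0 := bump_size_gt0 p s e0.
rewrite normrM (gtr0_norm mu0) powRM// ?(ltW mu0)// ler_wpM2r ?powR_ge0//.
rewrite ge0_ler_powR ?nnegrE ?(ltW p0)// normrM.
by rewrite ler_piMl.
Qed.

(** g is the telescoping sum of the T n.+1 - T n, where T n pairs with the bumps of L n at scale e
    n. The order of choices matters: quadrature fixes the L n, these fix the numbers m n of steps,
    and only then is e n taken small enough to make all copies cheap. None of the choices may depend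
    on the test function. *)
Lemma cheap_atomic_decomposition (R : realType) (p : R) (q : \bar R) (s : nat)
    (g : distribution_on_Rplus R) (eps : R) :
  0 < p -> p <= 1 -> (1 < q)%E -> s.+2%:R < p^-1 -> 0 < eps ->
  Hspace p q s g ->
  exists lam a, atomic_decomposition (@atom R p q s) p g lam a /\
    limn (series (fun k => `|lam k| `^ p)) <= eps.
Proof.
move=> p0 p1 q1 ps eps0 [lam [b [ab _ gb]]].
have /choice [Lq hLq] : forall n : nat, exists L : seq (R * R),
    (forall z, z \in L -> 0 < z.2) /\
    forall phi M, test_function phi -> (forall x, `|derive1n s.+2 phi x| <= M) ->
      `|series (fun k => lam k * integrate_against (b k) phi) n -
        discrete_pairing s L phi| <= n.+1%:R^-1 * M.
  move=> n; apply: (@partial_sum_quadrature R p q s lam b n n.+1%:R^-1 q1 ab).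
  by rewrite invr_gt0.
(* L 0 is empty so that the telescoping starts at 0; the entry (0, 1) has weight 0 and keeps every
   block nonempty. *)
pose L n := if n is n'.+1 then (0, 1) :: Lq n else [::].
have Lp n z : z \in L n -> 0 < z.2.
  case: n => [//|n]; rewrite inE => /predU1P[->//|].
  by have [h _] := hLq n.+1; exact: h.
have hL n phi M : test_function phi -> (forall x, `|derive1n s.+2 phi x| <= M) ->
    `|series (fun k => lam k * integrate_against (b k) phi) n -
      discrete_pairing s (L n) phi| <= n.+1%:R^-1 * M.
  case: n => [|n] tphi hM.
    rewrite /series /= big_geq// /discrete_pairing big_nil subrr normr0.
    by rewrite mulr_ge0// (le_trans _ (hM 0)).
  rewrite /discrete_pairing big_cons mul0r add0r.
  by have [_ h] := hLq n.+1; exact: h.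
pose W n := \sum_(z <- L n) `|z.1|.
have W0 n : 0 <= W n by exact: sumr_ge0.
pose V n := \sum_(z <- L n) `|z.1| `^ p.
have V0 n : 0 <= V n by apply: sumr_ge0 => z _; exact: powR_ge0.
(* One step then has total weight (W n.+1 + W n) / m n at most 1 / (n + 1), which controls the
   effect of stopping inside a step. *)
pose m n := (Num.truncn ((W n.+1 + W n) * n.+1%:R)).+1.
have m0 n : 0 < (m n)%:R :> R by rewrite ltr0n.
have mW n : (m n)%:R^-1 * (W n.+1 + W n) <= n.+1%:R^-1.
  rewrite mulrC ler_pdivrMr// mulrC ler_pdivlMr//.
  by rewrite ltW// truncnS_gt.
(* The budget: the blocks before n cost at most eps - half n, and block n at most half n.+1. *)
pose half n : R := eps * 2 ^- n.
have half0 n : 0 < half n by rewrite mulr_gt0// invr_gt0 exprn_gt0.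
have halfS n : half n.+1 + half n.+1 = half n.
  by rewrite /half exprS invfM; lra.
(* L n occurs in block n and in block n - 1, hence the two multiplicities; at n = 0 the default
   predecessor is harmless, as V 0 = 0. *)
pose cost n := V n * ((m n)%:R + (m n.-1)%:R).
have cost0 n : 0 <= cost n by rewrite mulr_ge0// addr_ge0.
have /choice [e he] : forall n : nat, exists e : R, [/\ 0 < e,
    forall z, z \in L n -> e < z.2, W n * (s.+2%:R * e) <= n.+1%:R^-1 &
    cost n * bump_size p e s `^ p <= half n.+2].
  by move=> n; apply: exists_scale => //; exact: Lp.
have e0 n : 0 < e n by have [] := he n.
(* Block [n] goes from [L n] at scale [e n] to [L n.+1] at scale [e n.+1] in
   [m n] equal steps, so that a step cut in the middle is a small error. *)
pose D n := scaled_bumps (m n)%:R^-1 (e n.+1) (L n.+1) ++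
  scaled_bumps (- (m n)%:R^-1) (e n) (L n).
pose blk n := flatten (nseq (m n) (D n)).
have [|t [idx [r [tE idxoo]]]] := @flatten_blocks _ (0, 1, 1) blk.
  by move=> n; rewrite /blk /= !size_cat.
have tD N : exists n, t N \in D n.
  have : t N \in mkseq t N.+1 by apply/mapP; exists N => //; rewrite mem_iota /= add0n.
  have blkD n : {subset blk n <= D n}.
    exact: mem_flatten_nseq.
  rewrite tE mem_cat => /orP[/flattenP[_ /mapP[n _ ->] /blkD ?]|/mem_take/blkD ?].
    by exists n.
  by exists (idx N.+1).
have valid N : 0 < (t N).2 < (t N).1.2.
  have [n] := tD N; rewrite mem_cat => /orP[|] /mapP[z zL ->] /=.
    by have [-> h _ _] := he n.+1; exact: h.
  by have [-> h _ _] := he n; exact: h.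
pose la k := (t k).1.1 * bump_size p (t k).2 s.
pose a k x := (bump_size p (t k).2 s)^-1 * bump (t k).2 s (t k).1.2 x.
have blkcost n : \sum_(z <- blk n) `|z.1.1 * bump_size p z.2 s| `^ p <= half n.+1.
  rewrite sum_flatten_nseq big_cat /= mulrDr.
  have m1 : `|(m n)%:R^-1| <= 1 :> R.
    by rewrite ger0_norm// invf_le1// ler1n.
  have m1' : `|- (m n)%:R^-1| <= 1 :> R by rewrite normrN.
  have [_ _ _ h1] := he n.+1; have [_ _ _ h2] := he n.
  have c1 : (m n)%:R * V n.+1 <= cost n.+1.
    by rewrite /cost /= mulrC; apply: ler_wpM2l; rewrite // lerDr.
  have c2 : (m n)%:R * V n <= cost n.
    by rewrite /cost /= mulrC; apply: ler_wpM2l; rewrite // lerDl.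
  rewrite -(halfS n.+1); apply: lerD.
    apply: le_trans (ler_wpM2l (ltW (m0 n)) (scaled_bumps_cost s (L n.+1) p0 m1 (e0 n.+1))) _.
    apply: le_trans (le_trans h1 _); last first.
      by rewrite -(halfS n.+2) lerDl ltW.
    by rewrite mulrA; apply: ler_wpM2r; [exact: powR_ge0|exact: c1].
  apply: le_trans (ler_wpM2l (ltW (m0 n)) (scaled_bumps_cost s (L n) p0 m1' (e0 n))) _.
  apply: le_trans h2.
  by rewrite mulrA; apply: ler_wpM2r; [exact: powR_ge0|exact: c2].
have Wcost n : \sum_(z <- flatten (mkseq blk n)) `|z.1.1 * bump_size p z.2 s| `^ p <=
    eps - half n.
  elim: n => [|n ih]; first by rewrite big_nil /half expr0 invr1 mulr1 subrr.
  rewrite mkseqS flatten_rcons big_cat /=.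
  apply: le_trans (lerD ih (blkcost n)) _.
  by rewrite -(halfS n); lra.
have seriesE (F : R * R * R -> R) N : series (fun k => F (t k)) N =
    \sum_(z <- mkseq t N) F z.
  by rewrite /series /= big_map /index_iota subn0.
have lacost N : series (fun k => `|la k| `^ p) N <= eps.
  rewrite /la (seriesE (fun z => `|z.1.1 * bump_size p z.2 s| `^ p)) tE big_cat /=.
  apply: (@le_trans _ _ (eps - half (idx N) + half (idx N).+1)).
    apply: lerD; first exact: Wcost.
    apply: le_trans (blkcost _); apply: sum_take_le => z; exact: powR_ge0.
  by rewrite -(halfS (idx N)); have := half0 (idx N).+1; lra.
have cla : cvgn (series (fun k => `|la k| `^ p)).
  apply: nondecreasing_is_cvgn.
    by apply: nondecreasing_series => k _ _; exact: powR_ge0.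
  by exists eps => _ [N _ <-].
exists la, a; split; last first.
  by apply: limr_le => //; apply: nearW.
split => //.
  by move=> k; rewrite /a; exact: bump_atom.
move=> phi tphi.
have [M hM] := bounded_derivatives s.+2 tphi.
have M1 x : `|derive1n s.+1 phi x| <= M by exact: hM.
have M2 x : `|derive1n s.+2 phi x| <= M by exact: hM.
have M0 : 0 <= M by exact: le_trans (normr_ge0 _) (M1 0).
pose T n := bump_sum s (e n) (L n) phi.
pose F (z : R * R * R) := z.1.1 * integrate_against (bump z.2 s z.1.2) phi.
have lapair k : la k * integrate_against (a k) phi = F (t k).
  have /andP[ek0 eky] := valid k.
  have cb := bump_carried s ek0 (lt_trans ek0 eky).
  rewrite /a (integrate_against_scale _ cb tphi) /la /F mulrA mulfK//.
  by rewrite gt_eqF// bump_size_gt0.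
have Tg : T @ \oo --> g phi.
  have small n : `|series (fun k => lam k * integrate_against (b k) phi) n - T n| <=
      2 * M * n.+1%:R^-1.
    have h1 := hL n phi M tphi M2.
    have h2 := bump_sum_error (e0 n) (Lp n) tphi M2.
    have [_ _ h3 _] := he n.
    have h4 : `|T n - discrete_pairing s (L n) phi| <= n.+1%:R^-1 * M.
      by apply: le_trans h2 _; rewrite ler_wpM2r.
    rewrite distrC in h4; move: h1 h4; set S := series _ n; set P := discrete_pairing _ _ _.
    move=> h1 h4; rewrite (_ : S - T n = (S - P) + (P - T n)); last by ring.
    apply: le_trans (ler_normD _ _) (le_trans (lerD h1 h4) _).
    by rewrite le_eqVlt; apply/orP; left; apply/eqP; ring.
  have d0 : (fun n => series (fun k => lam k * integrate_against (b k) phi) n - T n)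
      @ \oo --> 0.
    apply/norm_cvg0P; apply: (@squeeze_cvgr _ _ _ _ (cst 0) (fun n => 2 * M * n.+1%:R^-1)).
    - by apply: nearW => n; rewrite normr_ge0 small.
    - exact: cvg_cst.
    rewrite -[X in _ --> X](mulr0 (2 * M)); apply: cvgMr.
    exact: cvg_harmonic.
  have h := cvgB (gb phi tphi) d0; rewrite subr0 in h.
  rewrite (_ : T = fun n => series (fun k => lam k * integrate_against (b k) phi) n -
    (series (fun k => lam k * integrate_against (b k) phi) n - T n)); first exact: h.
  by apply/funext => n; rewrite opprB addrC subrK.
have sumD n : \sum_(z <- D n) F z = (m n)%:R^-1 * (T n.+1 - T n).
  transitivity ((m n)%:R^-1 * T n.+1 + (- (m n)%:R^-1) * T n); last by ring.
  by rewrite /T -!scaled_bumps_sum; exact: big_cat.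
have normD n : \sum_(z <- D n) `|F z| <= M * n.+1%:R^-1.
  have mi : 0 <= (m n)%:R^-1 :> R by [].
  have h1 := scaled_bumps_norm (e0 n.+1) mi (Lp n.+1) tphi M1.
  have h2 : \sum_(z <- scaled_bumps (- (m n)%:R^-1) (e n) (L n)) `|F z| <=
      (m n)%:R^-1 * W n * M.
    apply: le_trans (scaled_bumps_norm (e0 n) mi (Lp n) tphi M1).
    rewrite !big_map; apply: ler_sum => z _; rewrite /F /=.
    by rewrite !normrM normrN.
  apply: (@le_trans _ _ ((m n)%:R^-1 * W n.+1 * M + (m n)%:R^-1 * W n * M)).
    apply: le_trans (lerD h1 h2); rewrite le_eqVlt; apply/predU1P; left.
    exact: big_cat.
  by rewrite -mulrDl -mulrDr mulrC ler_wpM2l.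
have WT n : \sum_(z <- flatten (mkseq blk n)) F z = T n.
  elim: n => [|n ih]; first by rewrite /T /bump_sum !big_nil.
  rewrite mkseqS flatten_rcons big_cat ih sum_flatten_nseq sumD mulrA.
  by rewrite mulfV ?gt_eqF// mul1r /= addrC subrK.
(* The first N terms are idx N full blocks, then j of the m steps of the next block, then part of
   one step; theta is j / m. *)
have partial N : exists2 theta, 0 <= theta <= 1 &
    `|series (fun k => la k * integrate_against (a k) phi) N -
      (T (idx N) + theta * (T (idx N).+1 - T (idx N)))| <= M * (idx N).+1%:R^-1.
  have -> : series (fun k => la k * integrate_against (a k) phi) N =
      \sum_(z <- mkseq t N) F z.
    by rewrite -seriesE /series /=; apply: eq_bigr => k _; exact: lapair.
  rewrite tE big_cat WT; set n := idx N.
  have [j [r' [jm ->]]] := take_flatten_nseq (D n) (m n) (r N).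
  exists (j%:R * (m n)%:R^-1).
    by rewrite mulr_ge0//= ler_pdivrMr// mul1r ler_nat.
  rewrite big_cat sum_flatten_nseq sumD mulrA [X in X - _]/=.
  rewrite (_ : _ - _ = \sum_(z <- take r' (D n)) F z); last by ring.
  rewrite (le_trans (ler_norm_sum _ _ _))// (le_trans _ (normD n))//.
  exact: sum_take_le.
apply/cvgrPdist_le => eta eta0.
have [n1 _ hn1] : \forall n \near \oo, `|g phi - T n| <= eta / 2.
  by move/cvgrPdist_le : Tg; apply; rewrite divr_gt0.
have [n2 _ hn2] : \forall n \near \oo, `|0 - M * n.+1%:R^-1| <= eta / 2.
  have h : (fun n => M * n.+1%:R^-1) @ \oo --> (0 : R).
    rewrite -[X in _ --> X](mulr0 M); apply: cvgMr; exact: cvg_harmonic.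
  by move/cvgrPdist_le : h; apply; rewrite divr_gt0.
have [N0 hN0] := idxoo (maxn n1 n2).
exists N0 => // N /= /hN0; rewrite geq_max => /andP[i1 i2].
have [theta /andP[th0 th1] hth] := partial N.
have a1 := hn1 _ i1; have a2 := hn1 _ (leqW i1).
have a3 := hn2 _ i2; rewrite /= sub0r normrN in a3.
have a4 := le_trans hth (le_trans (ler_norm _) a3).
set S := series _ N in a4 *; set x := T (idx N) in a1 a4; set y := T (idx N).+1 in a2 a4.
(* S is close to a point of the segment between two consecutive values of T, and both ends are close
   to g phi. *)
rewrite (_ : g phi - S = ((1 - theta) * (g phi - x) + theta * (g phi - y)) -
  (S - (x + theta * (y - x)))); last by ring.
rewrite (le_trans (ler_normB _ _))// (splitr eta) lerD//.
rewrite (le_trans (ler_normD _ _))// !normrM (ger0_norm th0).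
rewrite (ger0_norm (_ : 0 <= 1 - theta)) ?subr_ge0//.
apply: (@le_trans _ _ ((1 - theta) * (eta / 2) + theta * (eta / 2))).
  by rewrite lerD// ler_wpM2l// subr_ge0.
by rewrite -mulrDl subrK mul1r.
Qed.

(** * Comparison of the quasinorms *)

Lemma hardy_decomposition (R : realType) (p : R) (q : \bar R) (s : nat)
    (f g : distribution_on_Rplus R) (lam : nat -> R) (a : nat -> R -> R) :
  0 < p -> (1 < q)%E -> atomic_decomposition (@Latom R p q s) p f lam a ->
  sum_in_distributions lam (fun k => hardy (a k)) g ->
  let c := 1 - fine q^-1 in
  atomic_decomposition (@atom R p q s) p g (fun k => c^-1 * lam k)
    (fun k x => c * hardy (a k) x) /\
  (limn (series (fun k => `|c^-1 * lam k| `^ p))) `^ p^-1 =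
    c^-1 * (limn (series (fun k => `|lam k| `^ p))) `^ p^-1.
Proof.
move=> p0 q1 [La cl _] hg c; have [_ c0] := fine_hoelder_conjugate q1.
have E : (fun k => `|c^-1 * lam k| `^ p) = (fun k => c^-1 `^ p * `|lam k| `^ p).
  apply/funext => k; rewrite normrM powRM// ger0_norm//.
  by rewrite invr_ge0 ltW.
have S0 : 0 <= limn (series (fun k => `|lam k| `^ p)).
  apply: limr_ge => //; apply: nearW => n; rewrite seriesEnat /=.
  by apply: sumr_ge0 => k _; exact: powR_ge0.
have cl' : cvgn (series (fun k => c^-1 `^ p * `|lam k| `^ p)).
  exact: (@is_cvg_seriesZ _ _ (c^-1 `^ p) cl).
split; last first.
  have -> : limn (series (fun k => `|c^-1 * lam k| `^ p)) =
      c^-1 `^ p * limn (series (fun k => `|lam k| `^ p)).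
    by rewrite E; exact: (@lim_seriesZ _ _ (c^-1 `^ p) cl).
  rewrite powRM ?powR_ge0// -powRrM divff ?gt_eqF// powRr1//.
  by rewrite invr_ge0 ltW.
split; first by move=> k; exact: hardy_atom.
  by rewrite E.
move=> phi tphi; have := hg phi tphi.
rewrite (_ : (fun k => lam k * _) = fun k => (c^-1 * lam k) *
  integrate_against (fun x => c * hardy (a k) x) phi)//.
apply/funext => k; have [u [v [_ _ _ ch]]] := Latom_hardy_carried q1 (La k).
rewrite (integrate_against_scale _ ch tphi) mulrACA mulVf ?mul1r//.
by rewrite gt_eqF.
Qed.

Lemma Hnorm_le0 (R : realType) (p : R) (q : \bar R) (s : nat)
    (g : distribution_on_Rplus R) :
  0 < p -> p <= 1 -> (1 < q)%E -> s.+2%:R < p^-1 -> Hspace p q s g ->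
  (Hnorm p q s g <= 0)%E.
Proof.
move=> p0 p1 q1 ps Hg; apply/lee_addgt0Pr => e e0; rewrite add0e.
(* The quasinorm takes a power 1/p of the cost, so a cost of at most e^p is requested. *)
have ep0 : 0 < e `^ p by exact: powR_gt0.
have [lam [a [dec le]]] := cheap_atomic_decomposition p0 p1 q1 ps ep0 Hg.
apply: ge_ereal_inf; exists ((limn (series (fun k => `|lam k| `^ p))) `^ p^-1)%:E.
  by exists lam, a.
have [_ cl _] := dec.
have S0 : 0 <= limn (series (fun k => `|lam k| `^ p)).
  apply: limr_ge => //; apply: nearW => n; rewrite seriesEnat /=.
  by apply: sumr_ge0 => k _; exact: powR_ge0.
have -> : e = (e `^ p) `^ p^-1 by rewrite -powRrM divff ?gt_eqF// powRr1// ltW.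
by rewrite lee_fin ge0_ler_powR ?nnegrE ?invr_ge0 ?(ltW p0) ?(ltW ep0).
Qed.

Unset Implicit Arguments.

Theorem theorem3 (R : realType) (p : R) (q : \bar R) (s : nat)
  (hp0 : 0 < p) (hp1 : p <= 1) (hq : (1 < q)%E)
  (f Hf : distribution_on_Rplus R)
  (hf0 : nonzero_distribution f)
  (hf : LHspace p q s f)
  (hHf : termwise_hardy p q s f Hf) :
  (Hnorm p q s Hf <= hoelder_conjugate q * LHnorm p q s f)%E.
Proof.
have [-> c0] := fine_hoelder_conjugate hq; set c := 1 - fine q^-1 in c0 *.
have [lam [a [dec hg]]] := hHf.
have [ps|ps] := leP p^-1 s.+2%:R; last first.
  have [decH _] := hardy_decomposition hp0 hq dec hg.
  apply: le_trans (Hnorm_le0 hp0 hp1 hq ps _) _.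
    by eexists; eexists; exact: decH.
  (* The left-hand side being at most 0, it remains to see that the right-hand side is
     nonnegative. *)
  apply: mule_ge0; first by rewrite lee_fin invr_ge0 ltW.
  by apply/ereal_infP => _ [lam' [a' [_ ->]]]; rewrite lee_fin powR_ge0.
(* The infimum over decompositions of f is tested on an arbitrary one: its image under H sums to the
   same [Hf], at q' times the cost. *)
rewrite lee_pdivlMl//; apply/ereal_infP => _ [lam' [a' [dec' ->]]].
rewrite -lee_pdivlMl// -EFinM.
have hg' := hardy_sum_transfer hp0 hp1 hq ps dec hg dec'.
have [decH' <-] := hardy_decomposition hp0 hq dec' hg'.
by apply: ge_ereal_inf; eexists; [eexists; eexists; split; [exact: decH'|reflexivity]|].
Qed.
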